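(* Let $k$ be a field of characteristic zero, let $(R,\Delta)$ be a commutative differential $k$-algebra, and let $H=(k^\times)^r$ be an algebraic torus acting rationally on $(R,\Delta)$. Assume that $R$ is affine over $k$, and that it has only finitely many prime $(H,\Delta)$-ideals. Let $J$ be one of them. For $P\in\Delta\text{-}\operatorname{spec}_J R$, the following conditions are equivalent: (a) $P$ is locally closed in $\Delta\text{-}\operatorname{spec}R$. (b) $P$ is $\Delta$-primitive. (c) $Z_\Delta(\operatorname{Fract}R/P)$ is algebraic over $k$. (d) $P$ is maximal in $\Delta\text{-}\operatorname{spec}_J R$.
   Context: Algebras are associative and unital. Affine means finitely generated as a $k$-algebra. A commutative differential $k$-algebra is a pair $(R,\Delta)$ with $R$ a commutative $k$-algebra and $\Delta$ a set of $k$-linear derivations on $R$. The $\Delta$-center is $Z_\Delta(R)=\{r\in R\mid\delta(r)=0\text{ for all }\delta\in\Delta\}$. A $\Delta$-ideal is an ideal $I$ with $\delta(I)\subseteq I$ for all $\delta\in\Delta$. The $\Delta$-core $(J:\Delta)$ of an ideal $J$ is the largest $\Delta$-ideal contained in $J$. A $\Delta$-prime ideal is a proper $\Delta$-ideal $Q$ such that for $\Delta$-ideals $I,J$ with $IJ\subseteq Q$, either $I\subseteq Q$ or $J\subseteq Q$ (when $R$ is noetherian, $\Delta$-prime ideals are prime). A $\Delta$-primitive ideal is an ideal of the form $(M:\Delta)$ with $M$ a maximal ideal of $R$. $\Delta\text{-}\operatorname{spec}R$ is the set of $\Delta$-prime ideals with the Zariski topology (closed sets $\{P\mid P\supseteq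 I\}$ for ideals $I$ of $R$). A point of a topological space is locally closed if it is (relatively) closed in some neighborhood of itself. For a $\Delta$-prime $P$, the derivations in $\Delta$ induce derivations on $R/P$ and extend to its quotient field $\operatorname{Fract}R/P$; $Z_\Delta(\operatorname{Fract}R/P)$ is taken with respect to these. An algebraic torus over $k$ is a group $H=(k^\times)^r$, $r\ge 0$; a rational character of $H$ is a group homomorphism $H\to k^\times$ that is also a morphism of algebraic varieties. When $H$ acts linearly on a $k$-vector space, an $H$-eigenvector is a nonzero $v$ with $h(v)\in kv$ for all $h\in H$; its $H$-eigenvalue is the character $f$ with $h(v)=f(h)v$ for all $h$. An action of $H$ on $R$ by $k$-algebra automorphisms is rational if $R$ is the direct sum of its $H$-eigenspaces and all corresponding $H$-eigenvalues are rational characters. $H$ acts on $\operatorname{Der}_k(R)$ by $h.\delta=h\circ\delta\circ h^{-1}$. $H$ acts rationally on $(R,\Delta)$ if (1) $H$ acts rationally on $R$ by $k$-algebra automorphisms; (2) $\Delta$ is a linear subspace of $\operatorname{Der}_k(R)$ stable under the induced $H$-action; (3) $\Delta$ is the direct sum of its $H$-eigenspaces, and the corresponding $H$-eigenvalues are all rational. An $(H,\Delta)$-ideal is an ideal stable under both $H$ and $\Delta$; a prime $(H,\Delta)$-ideal is one that is a prime ideal. For an ideal $I$, $(I:H)=\bigcap_{h\in H}h(I)$. For a prime $(H,\Delta)$-ideal $J$, $\Delta\text{-}\operatorname{spec}_J R=\{P\in\Delta\text{-}\operatorname{spec}R\mid(P:H)=J\}$. Maximality in (d) is with respect to inclusion.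 *)

(* Defs.v *)
From HB Require Import structures.
From mathcomp Require Import all_boot all_order all_algebra.
From mathcomp Require Import ring_quotient generic_quotient.
From mathcomp Require Import mathcomp_extra boolp classical_sets functions.
From mathcomp Require Import cardinality filter topology_structure.

Set Implicit Arguments.
Unset Strict Implicit.
Unset Printing Implicit Defensive.

Import GRing.Theory.

Local Open Scope classical_set_scope.
Local Open Scope ring_scope.
Local Open Scope quotient_scope.

Local Notation "x %:F" := (FracField.tofrac x).

Section Ideals.
Variable R : comNzRingType.
Implicit Types (I J M P : set R).

Definition ideal I :=
  [/\ I 0, forall x y, I x -> I y -> I (x + y) & forall a x, I x -> I (a * x)].

Definition prime_ideal P :=
  [/\ ideal P, ~ P 1 & forall x y, P (x * y) -> P x \/ P y].

Definition maximal_ideal M :=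
  [/\ ideal M, M <> setT & forall I, ideal I -> M `<=` I -> I = M \/ I = setT].

Definition ideal_mul I J : set R :=
  smallest ideal [set z | exists2 x, I x & exists2 y, J y & z = x * y].

End Ideals.

Section Residue.
Variables (R : comNzRingType) (P : set R) (primeP : prime_ideal P).

Definition ideal_pred : R -> bool := fun x => `[< P x >].

Lemma ideal_pred_idealr : idealr_closed ideal_pred.
Proof.
have [[P0 PD PM] P1 _] := primeP; split.
- exact/asboolP.
- by apply/negP => /asboolP.
- by move=> a u v /asboolP Pu /asboolP Pv; apply/asboolP/PD => //; apply: PM.
Qed.

Lemma ideal_pred_prime : prime_idealr_closed ideal_pred.
Proof.
have [_ _ pr] := primeP => u v /asboolP /pr [Pu|Pv].
  by apply/orP; left; apply/asboolP.
by apply/orP; right; apply/asboolP.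
Qed.

Definition prime_idealr_of : prime_idealr R :=
  HB.pack_for (prime_idealr R) ideal_pred
    (isIdealr.Build R _ ideal_pred_idealr)
    (isPrimeIdealrClosed.Build R _ ideal_pred_prime).

Definition residue_ring := {ideal_quot prime_idealr_of}.

HB.instance Definition _ := GRing.ComNzRing.on residue_ring.

(* [{ideal_quot _}] only comes with a ring structure; [{fraction _}] also needs
   an inversion function on the units, which exists classically. *)
Definition residue_unit (x : residue_ring) : bool :=
  `[< exists y : residue_ring, y * x = 1 >].

Definition residue_inv (x : residue_ring) : residue_ring :=
  if pselect (exists y : residue_ring, y * x = 1) is left ex
  then projT1 (cid ex) else x.

Lemma residue_mulVx : {in residue_unit, left_inverse 1 residue_inv *%R}.
Proof.
move=> x /asboolP ux; rewrite /residue_inv; case: pselect => // ex.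
by case: (cid ex).
Qed.

Lemma residue_unitPl (x y : residue_ring) : y * x = 1 -> residue_unit x.
Proof. by move=> yx1; apply/asboolP; exists y. Qed.

Lemma residue_invr_out : {in [predC residue_unit], residue_inv =1 id}.
Proof.
by move=> x /asboolPn nux; rewrite /residue_inv; case: pselect.
Qed.

HB.instance Definition _ := GRing.ComNzRing_hasMulInverse.Build residue_ring
  residue_mulVx residue_unitPl residue_invr_out.
HB.instance Definition _ := GRing.ComUnitRing_isIntegral.Build residue_ring
  (@Quotient.rquot_IdomainAxiom R prime_idealr_of).

Definition residue (x : R) : residue_ring := \pi x.

Definition fract := {fraction residue_ring}.

(* The derivation that a derivation [d] of [R] with [d P \subset P] induces on
   [R / P], and the extension of the latter to the fraction field by the
   quotient rule.  Both are computed on the representatives chosen by [repr];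
   the values do not depend on the choice. *)
Definition residue_der (d : R -> R) (x : residue_ring) : residue_ring :=
  residue (d (repr x)).

Definition fract_der (d : R -> R) (z : fract) : fract :=
  let n := \n_(repr z) in let m := \d_(repr z) in
  (residue_der d n * m - n * residue_der d m)%:F / (m ^+ 2)%:F.

End Residue.

Section Differential.
Variables (k : fieldType) (R : comAlgType k).

Definition derivation (d : R -> R) :=
  linear d /\ forall x y, d (x * y) = d x * y + x * d y.

Definition subalgebra (A : set R) :=
  [/\ A 1, forall (c : k) x y, A x -> A y -> A (c *: x + y)
         & forall x y, A x -> A y -> A (x * y)].

Definition affine := exists s : seq R, smallest subalgebra [set` s] = setT.

Variable Delta : set (R -> R).

Definition dstable (I : set R) := forall d x, Delta d -> I x -> I (d x).

Definition dideal (I : set R) := ideal I /\ dstable I.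

Definition dprime (Q : set R) :=
  [/\ dideal Q, Q <> setT & forall I J, dideal I -> dideal J ->
        ideal_mul I J `<=` Q -> I `<=` Q \/ J `<=` Q].

(* [C] is the Delta-core [(J : Delta)]. *)
Definition is_dcore (J C : set R) :=
  [/\ dideal C, C `<=` J & forall I, dideal I -> I `<=` J -> I `<=` C].

Definition dprimitive (P : set R) :=
  exists2 M, maximal_ideal M & is_dcore M P.

Section Fract.
Variables (P : set R) (primeP : prime_ideal P).

Definition fract_scalar (c : k) : fract primeP := (residue primeP c%:A)%:F.

Definition dcenter_fract : set (fract primeP) :=
  [set z | forall d, Delta d -> fract_der d z = 0].

Definition dcenter_fract_algebraic :=
  forall z, dcenter_fract z -> algebraicOver fract_scalar z.

End Fract.

Record dspec := DSpec { dspec_set :> set R ; dspecP : dprime dspec_set }.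

HB.instance Definition _ := gen_eqMixin dspec.
HB.instance Definition _ := gen_choiceMixin dspec.

Definition dspec_open (U : set dspec) :=
  exists2 I : set R, ideal I & ~` U = [set P : dspec | I `<=` P].

Let kernel (V : set dspec) : set R := [set x | forall P, V P -> (P : set R) x].

Let kernel_dideal V : dideal (kernel V).
Proof.
split; first split.
- by move=> P _; have [[[]]] := dspecP P.
- move=> x y Vx Vy P VP; have [[[_ D _] _] _ _] := dspecP P.
  by apply: D; [apply: Vx|apply: Vy].
- move=> a x Vx P VP; have [[[_ _ M] _] _ _] := dspecP P.
  by apply: M; apply: Vx.
- move=> d x Dd Vx P VP; have [[_ st] _ _] := dspecP P.
  by apply: st => //; apply: Vx.
Qed.

Let dspec_openT : dspec_open setT.
Proof.
exists setT; first by split.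
rewrite setCT; apply/seteqP; split=> // P /= PT.
by have [_ + _] := dspecP P; apply; apply/seteqP.
Qed.

Let dspec_openI : setI_closed dspec_open.
Proof.
move=> U V [I idI UI] [J idJ VJ]; set W := ~` (U `&` V).
have [idK _] := kernel_dideal W; exists (kernel W) => //.
apply/seteqP; split=> P; first by move=> WP x; apply.
move=> /= KP [UP VP]; have [[idP _] _ prP] := dspecP P.
suff [sP|sP] : kernel (~` U) `<=` P \/ kernel (~` V) `<=` P.
- have : (~` U) P by rewrite UI /= => x Ix; apply: sP => Q; rewrite UI; apply.
  exact.
- have : (~` V) P by rewrite VJ /= => x Jx; apply: sP => Q; rewrite VJ; apply.
  exact.
apply: prP; [exact: kernel_dideal|exact: kernel_dideal|].
apply: subset_trans KP; apply: smallest_sub => //.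
move=> _ [x Ux [y Vy ->]] Q; rewrite /W setCI => -[nU|nV].
  have [[[_ _ M] _] _ _] := dspecP Q.
  by rewrite mulrC; apply: M; apply: Ux.
have [[[_ _ M] _] _ _] := dspecP Q.
by apply: M; apply: Vy.
Qed.

Let dspec_open_bigcup (T : Type) (U : T -> set dspec) :
  (forall i, dspec_open (U i)) -> dspec_open (\bigcup_i U i).
Proof.
move=> Uop; set W := ~` (\bigcup_i U i).
have [idK _] := kernel_dideal W; exists (kernel W) => //.
apply/seteqP; split=> P; first by move=> WP x; apply.
move=> /= KP [i _ UiP]; have [I idI UI] := Uop i.
have : (~` U i) P.
  rewrite UI /= => x Ix; apply: KP => Q WQ.
  have : (~` U i) Q by move=> UiQ; apply: WQ; exists i.
  by rewrite UI; apply.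
exact.
Qed.

HB.instance Definition _ := isOpenTopological.Build dspec
  dspec_openT dspec_openI dspec_open_bigcup.

End Differential.

Definition locally_closed_point (T : topologicalType) (x : T) :=
  exists2 U : set T, nbhs x U &
    exists2 C : set T, closed C & [set x] = C `&` U.

Definition kstar (k : fieldType) : Type := {x : k | x != 0}.

Section UnitGroup.
Variable k : fieldType.

HB.instance Definition _ := SubChoice.on (kstar k).

Definition kstar1 : kstar k := exist _ 1 (oner_neq0 k).
Definition kstar_mul (x y : kstar k) : kstar k :=
  exist _ (val x * val y) (mulf_neq0 (valP x) (valP y)).
Definition kstar_inv (x : kstar k) : kstar k :=
  exist _ (val x)^-1 (invr_neq0 (valP x)).

Lemma kstar_mulA : associative kstar_mul.
Proof. by move=> x y z; apply: val_inj; rewrite /= mulrA. Qed.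
Lemma kstar_mul1 : left_id kstar1 kstar_mul.
Proof. by move=> x; apply: val_inj; rewrite /= mul1r. Qed.
Lemma kstar_mulr1 : right_id kstar1 kstar_mul.
Proof. by move=> x; apply: val_inj; rewrite /= mulr1. Qed.
Lemma kstar_mulV : left_inverse kstar1 kstar_inv kstar_mul.
Proof. by move=> x; apply: val_inj; rewrite /= mulVf ?(valP x). Qed.
Lemma kstar_mulrV : right_inverse kstar1 kstar_inv kstar_mul.
Proof. by move=> x; apply: val_inj; rewrite /= divff ?(valP x). Qed.

HB.instance Definition _ := isGroup.Build (kstar k)
  kstar_mulA kstar_mul1 kstar_mulr1 kstar_mulV kstar_mulrV.

End UnitGroup.

Definition torus (k : fieldType) (r : nat) : Type := {ffun 'I_r -> kstar k}.

HB.instance Definition _ k r := Group.on (torus k r).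

Section RationalActions.
Variables (k : fieldType) (r : nat).
Local Notation H := (torus k r).

(* The coordinate ring of [H]: Laurent polynomials in the coordinates. *)
Inductive regular_function : (H -> k) -> Prop :=
| regular_const c : regular_function (fun=> c)
| regular_coord i : regular_function (fun h => val (h i))
| regular_coordV i : regular_function (fun h => (val (h i))^-1)
| regular_add f g : regular_function f -> regular_function g ->
    regular_function (fun h => f h + g h)
| regular_mul f g : regular_function f -> regular_function g ->
    regular_function (fun h => f h * g h).

(* A morphism of varieties [H -> k^*] pulls the coordinate ring [k[t, t^-1]] of
   [k^*] back into that of [H]. *)
Definition variety_morphism (chi : H -> kstar k) :=
  regular_function (fun h => val (chi h)) /\
  regular_function (fun h => (val (chi h))^-1).

Definition rational_character (f : H -> k) :=
  exists2 chi : {multiplicative H -> kstar k},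
    variety_morphism chi & forall h, f h = val (chi h).

Section Eigen.
Variables (V : lmodType k) (a : H -> V -> V).

Definition eigenspace_of (f : H -> k) : set V :=
  [set v | forall h, a h v = f h *: v].

Definition eigenvector (v : V) (f : H -> k) := v <> 0 /\ eigenspace_of f v.

(* [W] is the direct sum (it is spanned by its eigenvectors, and eigenspaces for
   distinct eigenvalues are independent) of its eigenspaces, and all the
   eigenvalues occurring in [W] are rational characters. *)
Definition rational_on (W : set V) :=
  [/\ forall v, W v -> exists2 s : seq V,
        {in s, forall u, W u /\ exists f, eigenvector u f} &
        v = \sum_(u <- s) u,
      forall n (f : 'I_n -> H -> k) (v : 'I_n -> V), injective f ->
        (forall i, W (v i) /\ eigenspace_of (f i) (v i)) ->
        \sum_i v i = 0 -> forall i, v i = 0 &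
      forall v f, W v -> eigenvector v f -> rational_character f].

End Eigen.

Variable R : comAlgType k.
Variable act : H -> {lrmorphism R -> R}.

Definition group_action :=
  (forall x, act 1%g x = x) /\
  forall g h x, act (g * h)%g x = act g (act h x).

Definition der_act (h : H) (d : R -> R) : R -> R := act h \o d \o act h^-1%g.

Variable Delta : set (R -> R).

Definition linear_subspace :=
  Delta 0 /\ forall (c : k) d e, Delta d -> Delta e -> Delta (c *: d + e).

Definition rational_daction :=
  [/\ group_action, rational_on act setT,
      linear_subspace, forall h d, Delta d -> Delta (der_act h d)
    & rational_on der_act Delta].

Definition hstable (I : set R) := forall h x, I x -> I (act h x).

(* prime (H, Delta)-ideals *)
Definition hdprime (Q : set R) :=
  [/\ prime_ideal Q, hstable Q & dstable Delta Q].

(* [(I : H)] *)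
Definition hcore (I : set R) : set R := \bigcap_(h in [set: H]) (act h @` I).

Definition dspec_stratum (J : set R) : set (dspec Delta) :=
  [set P : dspec Delta | hcore P = J].

End RationalActions.

Definition maximal_in (k : fieldType) (R : comAlgType k) (Delta : set (R -> R))
    (S : set (dspec Delta)) (P : dspec Delta) :=
  S P /\ forall Q : dspec Delta, S Q -> P `<=` Q -> Q = P.

(* Main.v *)
(** The implications (a) => (b) => (c) hold without the torus. Locally closed
points are primitive because affine algebras are Jacobson rings (via Zariski's
lemma) and the Delta-core of a maximal ideal is Delta-prime. If [P] is the core
of a maximal ideal [M], the denominators of a central [z] of [Fract R/P] form a
Delta-ideal larger than [P], so the center embeds in the residue field of [M],
which is algebraic over [k].

(c) => (d): let [Q] contain [P] with [(Q : H) = (P : H)]. Choose [a] in [Q]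
outside [P], a sum of the fewest eigenvectors, and let [u] be one of them. For
an eigenvector [d] in Delta, [u d(a) - d(u) a] has fewer terms, so it is in [P].
Hence [u / a] is central in [Fract R/P], and an algebraic equation for it forces
a power of [u] into [Q], so [u] is in [(Q : H)] and in [P], which contradicts
minimality.

(d) => (a): for [Q] Delta-prime, [(Q : H)] is one of the finitely many prime
(H, Delta)-ideals, so the Delta-primes properly above [P] contain the
intersection of those properly above [J], which does not lie in [P]. *)

Require Import Defs.
From HB Require Import structures.
From mathcomp Require Import all_boot all_order all_algebra.
From mathcomp Require Import ring_quotient generic_quotient ring.
From mathcomp Require Import boolp classical_sets functions cardinality.
From mathcomp Require Import filter topology_structure.

Set Implicit Arguments.
Unset Strict Implicit.
Unset Printing Implicit Defensive.

Import GRing.Theory.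

Local Open Scope classical_set_scope.
Local Open Scope ring_scope.

(** * Noetherian rings *)

(** Dependent choice in which each new term may depend on all earlier ones. It builds the infinite
    sequences that contradict a noetherian hypothesis. *)
Lemma history_choice (T : Type) (good : seq T -> Prop) (G : seq T -> T -> Prop) :
  good [::] ->
  (forall l, good l -> exists2 x, G l x & good (rcons l x)) ->
  exists u : nat -> T, forall n, good (mkseq u n) /\ G (mkseq u n) (u n).
Proof.
move=> good0 step.
have [x0 _ _] := step _ good0.
have [f fP] : {f : seq T -> seq T * T & forall l, good l ->
    [/\ G l (f l).2, good (f l).1 & (f l).1 = rcons l (f l).2]}.
  apply: (@choice _ _ (fun l y => good l ->
    [/\ G l y.2, good y.1 & y.1 = rcons l y.2])) => l.
  have [gl|ngl] := EM (good l); last by exists (l, x0).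
  by have [x Gx gx] := step l gl; exists (rcons l x, x).
pose L n := iter n (fun l => (f l).1) [::].
have gL n : good (L n).
  by elim: n => [//|n IH]; rewrite /L iterS; have [] := fP _ IH.
exists (fun n => (f (L n)).2) => n.
suff -> : mkseq (fun n => (f (L n)).2) n = L n.
  by split; [exact: gL | have [] := fP _ (gL n)].
elim: n => [//|n IH]; rewrite /mkseq -addn1 iotaD map_cat -/(mkseq _ _) IH.
by rewrite addn1 /L iterS cats1; have [_ _ ->] := fP _ (gL n).
Qed.

Section Noetherian.
Variable R : comNzRingType.
Implicit Types (u : nat -> R) (I J P Q : set R).

Definition span_lt u n : set R :=
  [set x | exists c : nat -> R, x = \sum_(i < n) c i * u i].

(* Equivalent to the finite generation of all ideals. *)
Definition noetherian := forall u, exists n, span_lt u n (u n).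

Lemma ideal_span u n : ideal (span_lt u n).
Proof.
split.
- by exists (fun=> 0); rewrite big1 // => i _; rewrite mul0r.
- move=> _ _ [c ->] [d ->]; exists (fun i => c i + d i).
  by rewrite -big_split; apply: eq_bigr => i _; rewrite mulrDl.
- move=> a _ [c ->]; exists (fun i => a * c i).
  by rewrite mulr_sumr; apply: eq_bigr => i _; rewrite mulrA.
Qed.

Lemma idealN I x : ideal I -> I x -> I (- x).
Proof. by move=> [_ _ IM] Ix; rewrite -mulN1r; apply: IM. Qed.

Lemma idealB I x y : ideal I -> I x -> I y -> I (x - y).
Proof. by move=> idI Ix Iy; have [_ ID _] := idI; apply: ID => //; exact: idealN. Qed.

Lemma ideal_sum I (T : Type) (s : seq T) (C : pred T) (F : T -> R) :
  ideal I -> (forall i, C i -> I (F i)) -> I (\sum_(i <- s | C i) F i).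
Proof. by move=> [I0 ID _] IF; exact: (big_ind I I0 ID IF). Qed.

Lemma ideal_setT I : ideal I -> I 1 -> I = setT.
Proof.
by move=> [_ _ IM] I1; apply/seteqP; split=> // x _; rewrite -[x]mulr1; apply: IM.
Qed.

Lemma span_ltS u n m : (n <= m)%N -> span_lt u n `<=` span_lt u m.
Proof.
move=> nm _ [c ->]; exists (fun i => if (i < n)%N then c i else 0).
rewrite [RHS](bigID (fun i : 'I_m => i < n)%N) /= addrC.
rewrite [X in _ = X + _]big1 ?add0r => [|i /negbTE ->]; last by rewrite mul0r.
rewrite (big_ord_widen m (fun i => c i * u i)) //.
by apply: eq_bigr => i ->.
Qed.

Lemma mem_span u n i : (i < n)%N -> span_lt u n (u i).
Proof.
move=> ltin; exists (fun j => (j == i)%:R).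
rewrite (bigD1 (Ordinal ltin)) //= eqxx mul1r big1 ?addr0 // => j.
by rewrite -val_eqE /= => /negbTE ->; rewrite mul0r.
Qed.

Lemma sub_span u n I : ideal I -> (forall i, (i < n)%N -> I (u i)) ->
  span_lt u n `<=` I.
Proof.
move=> idI Iu _ [c ->]; apply: ideal_sum => // i _.
by have [_ _ IM] := idI; apply/IM/Iu.
Qed.

(** If no finite family sufficed, elements of [I] could be picked one after another outside the
    ideal of the earlier ones. *)
Lemma noetherian_fg I : noetherian ->
  exists u n, (forall i, (i < n)%N -> I (u i)) /\ I `<=` span_lt u n.
Proof.
move=> noeR; apply: contrapT => nfg.
pose good (l : seq R) := forall i, (i < size l)%N -> I l`_i.
pose G (l : seq R) x := ~ span_lt (nth 0 l) (size l) x.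
have step l : good l -> exists2 x, G l x & good (rcons l x).
  move=> gl.
  have [x [Ix nx]] : exists x, I x /\ G l x.
    apply: contrapT => H; apply: nfg; exists (nth 0 l), (size l); split=> // x Ix.
    by apply: contrapT => nx; apply: H; exists x.
  exists x => // i; rewrite size_rcons ltnS nth_rcons leq_eqVlt.
  by case: ltngtP => //= lti _; apply: gl.
have good0 : good [::] by [].
have [u uP] := history_choice good0 step.
have [n [c unE]] := noeR u; have [_] := uP n; apply; exists c.
rewrite size_mkseq {1}unE; apply: eq_bigr => i _.
by rewrite nth_mkseq.
Qed.

End Noetherian.

(** Hilbert's basis theorem. In the ideal generated by a bad sequence [u], each [p n] is chosen of
    least size outside the ideal of the earlier ones; a relation among the leading coefficients then
    yields a smaller candidate. *)
Theorem noetherian_poly (S : comNzRingType) : noetherian S -> noetherian {poly S}.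
Proof.
move=> noeS u; apply: contrapT => nu.
have {}nu n : ~ span_lt u n (u n) by move=> un; apply: nu; exists n.
pose I : set {poly S} := [set x | exists n, span_lt u n x].
have idI : ideal I.
  split.
  - by exists 0; have [] := ideal_span u 0.
  - move=> x y [n nx] [m my]; exists (maxn n m).
    have [_ D _] := ideal_span u (maxn n m).
    by apply: D; [apply: span_ltS nx|apply: span_ltS my]; rewrite ?leq_maxl ?leq_maxr.
  - by move=> a x [n nx]; exists n; have [_ _ M] := ideal_span u n; apply: M.
pose good (l : seq {poly S}) := forall i, (i < size l)%N -> I l`_i.
pose out (l : seq {poly S}) x := I x /\ ~ span_lt (nth 0 l) (size l) x.
pose G l x := out l x /\ forall y, out l y -> (size x <= size y)%N.
have step l : good l -> exists2 x, G l x & good (rcons l x).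
  move=> gl.
  (* The list lies in the ideal of the first [N] terms of [u], so [u N] is outside the ideal of the
     list and a candidate exists. *)
  have [N NP] : exists N, forall i, (i < size l)%N -> span_lt u N l`_i.
    have Il i : exists N, (i < size l)%N -> span_lt u N l`_i.
      case: (ltnP i (size l)) => [lti|_]; last by exists 0.
      by have [N HN] := gl i lti; exists N.
    have [f fP] := choice Il; exists (\max_(i < size l) f i) => i lti.
    apply: span_ltS (fP i lti); exact: (leq_bigmax (Ordinal lti)).
  have outu : out l (u N).
    split; first by exists N.+1; apply: mem_span.
    by move=> /(sub_span (ideal_span u N) NP); apply: nu.
  pose sz n := `[< exists2 x, out l x & size x = n >].
  have exsz : exists n, sz n by exists (size (u N)); apply/asboolP; exists (u N).
  case: (ex_minnP exsz) => m /asboolP[x outx sizex] mmin.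
  exists x.
    by split=> // y outy; rewrite sizex; apply: mmin; apply/asboolP; exists y.
  move=> i; rewrite size_rcons ltnS nth_rcons leq_eqVlt.
  by case: ltngtP => //= [lti _|_ _]; [apply: gl | case: outx].
have good0 : good [::] by [].
have [p pP] := history_choice good0 step.
have Ip n : I (p n) by have [_ [[]]] := pP n.
have np n : ~ span_lt p n (p n).
  have [_ [[_ H] _]] := pP n => -[c cE]; apply: H; exists c.
  rewrite size_mkseq {1}cE; apply: eq_bigr => i _.
  by rewrite nth_mkseq.
have pmin n y : I y -> ~ span_lt p n y -> (size (p n) <= size y)%N.
  move=> Iy ny; have [_ [_]] := pP n; apply; split=> // -[c yE]; apply: ny.
  exists c; rewrite yE size_mkseq; apply: eq_bigr => i _.
  by rewrite nth_mkseq.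
have sizep i n : (i <= n)%N -> (size (p i) <= size (p n))%N.
  by move=> lein; apply: pmin => // /(span_ltS lein); apply: np.
have [n [c cE]] := noeS (fun n => lead_coef (p n)).
have pn0 : p n != 0.
  by apply/eqP => pn0; apply: (np n); rewrite pn0; have [] := ideal_span p n.
(* The shifts align the leading terms, so that [p n - q] has smaller size than [p n]. *)
pose q := \sum_(i < n) (c i *: 'X^(size (p n) - size (p i))) * p i.
have qspan : span_lt p n q.
  by exists (fun i => c i *: 'X^(size (p n) - size (p i))).
have Ipq : I (p n - q) by apply: idealB => //; apply: sub_span qspan.
have npq : ~ span_lt p n (p n - q).
  move=> H; apply: (np n); rewrite -[p n](subrK q).
  by have [_ D _] := ideal_span p n; apply: D.
have := pmin n _ Ipq npq; rewrite leqNgt => /negP; apply.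
rewrite -(prednK (n := size (p n))) ?size_poly_gt0 // ltnS.
apply/leq_sizeP => j; rewrite leq_eqVlt => /predU1P[<-|ltj].
  rewrite coefB -lead_coefE cE coef_sum -sumrB big1 // => i _.
  rewrite -scalerAl coefZ coefXnM.
  have := sizep i n (ltnW (ltn_ord i)).
  have spn : (0 < size (p n))%N by rewrite size_poly_gt0.
  (* If [p i] is zero, its size 0 makes the shift exceed the coefficient index; both terms vanish
     anyway. *)
  case: (posnP (size (p i))) => [si0|si_gt0] le_in.
    by rewrite lead_coefE si0 !nth_default ?si0 // if_same subrr.
  have -> : ((size (p n)).-1 < size (p n) - size (p i))%N = false.
    by apply/negbTE; rewrite -leqNgt -subn1 leq_sub2l.
  by rewrite -!subn1 subnAC subKn // subn1 -lead_coefE subrr.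
have lej : (size (p n) <= j)%N by rewrite -(prednK (n := size (p n))) ?size_poly_gt0.
rewrite coefB (nth_default 0 lej) sub0r coef_sum big1 ?oppr0 // => i _.
have le_in := sizep i n (ltnW (ltn_ord i)).
rewrite -scalerAl coefZ coefXnM; case: ifP => _; first by rewrite mulr0.
rewrite [(p i)`_ _]nth_default ?mulr0 //.
by rewrite -[X in (X <= _)%N](subKn le_in) leq_sub2r.
Qed.

(** * Affine algebras and Zariski's lemma *)

Section Adjoin.
Variable T : comNzRingType.

Definition eval_morph (S : comNzRingType) (phi : {rmorphism S -> T}) (x : T) :
    {rmorphism {poly S} -> T} :=
  horner_morph (fun a => mulrC x (phi a)).

Lemma eval_morphC (S : comNzRingType) (phi : {rmorphism S -> T}) x a :
  eval_morph phi x a%:P = phi a.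
Proof. exact: horner_morphC. Qed.

Lemma eval_morphX (S : comNzRingType) (phi : {rmorphism S -> T}) x :
  eval_morph phi x 'X = x.
Proof. exact: horner_morphX. Qed.

(** The subring generated by the image of [phi] and [xs], encoded as the range of an iterated
    evaluation: each generator replaces [S] by [{poly S}], so that results on one polynomial
    variable apply by induction on [xs]. *)
Fixpoint adjoin (S : comNzRingType) (phi : {rmorphism S -> T}) (xs : seq T) : set T :=
  if xs is x :: xs' then adjoin (eval_morph phi x) xs' else range phi.

Lemma adjoin_base (S : comNzRingType) (phi : {rmorphism S -> T}) xs a :
  adjoin phi xs (phi a).
Proof.
elim: xs S phi a => [|x xs IH] S phi a /=; first by exists a.
by rewrite -(eval_morphC phi x); apply: IH.
Qed.

Lemma adjoin_mem (S : comNzRingType) (phi : {rmorphism S -> T}) xs x :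
  x \in xs -> adjoin phi xs x.
Proof.
elim: xs S phi => [//|y xs IH] S phi; rewrite inE => /predU1P[->|/IH] /=; last exact.
by rewrite -{2}(eval_morphX phi y); apply: adjoin_base.
Qed.

Lemma adjoinD (S : comNzRingType) (phi : {rmorphism S -> T}) xs x y :
  adjoin phi xs x -> adjoin phi xs y -> adjoin phi xs (x + y).
Proof.
elim: xs S phi => [|z xs IH] S phi /=; last exact: IH.
by move=> [a _ <-] [b _ <-]; exists (a + b); rewrite ?rmorphD.
Qed.

Lemma adjoinM (S : comNzRingType) (phi : {rmorphism S -> T}) xs x y :
  adjoin phi xs x -> adjoin phi xs y -> adjoin phi xs (x * y).
Proof.
elim: xs S phi => [|z xs IH] S phi /=; last exact: IH.
by move=> [a _ <-] [b _ <-]; exists (a * b); rewrite ?rmorphM.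
Qed.

Lemma noetherian_adjoin (S : comNzRingType) (phi : {rmorphism S -> T}) xs :
  noetherian S -> adjoin phi xs = setT -> noetherian T.
Proof.
elim: xs S phi => [|x xs IH] S phi noeS /= adjT; last first.
  by apply: IH adjT; apply: noetherian_poly.
move=> u; have lift n : exists a, phi a = u n.
  have : range phi (u n) by rewrite adjT.
  by case=> a _ <-; exists a.
have [v vE] := choice lift; have [n [c cE]] := noeS v.
exists n, (phi \o c); rewrite -vE cE rmorph_sum; apply: eq_bigr => i _.
by rewrite rmorphM vE.
Qed.

End Adjoin.

Section AffineImage.
Variables (k : fieldType) (R : comAlgType k) (T : comNzRingType).
Variable psi : {rmorphism R -> T}.

(** Further entries are allowed in [ys] so that a chosen element can be put in front of the images
    of the generators. *)
Lemma adjoin_affine (s : seq R) (ys : seq T) :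
  smallest (@subalgebra k R) [set` s] = setT -> {subset map psi s <= ys} ->
  forall x, adjoin (psi \o in_alg R) ys (psi x).
Proof.
move=> sT sub x.
suff /(_ x) : smallest (@subalgebra k R) [set` s] `<=`
    [set x | adjoin (psi \o in_alg R) ys (psi x)] by rewrite sT; apply.
apply: smallest_sub => /=; last first.
  by move=> y ys_y; apply: adjoin_mem; apply: sub; apply: map_f.
split=> [|c y z /= Ay Az|y z /= Ay Az] /=.
- by rewrite rmorph1 -(rmorph1 (psi \o in_alg R)); apply: adjoin_base.
- rewrite rmorphD -mulr_algl rmorphM; apply: adjoinD => //.
  by apply: adjoinM => //; apply: (adjoin_base (psi \o in_alg R)).
- by rewrite rmorphM; apply: adjoinM.
Qed.

End AffineImage.

Lemma noetherian_field (k : fieldType) : noetherian k.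
Proof.
move=> u; have [u0|u0] := eqVneq (u 0) 0.
  by exists 0; exists (fun=> 0); rewrite big_ord0.
by exists 1; exists (fun=> u 1 / u 0); rewrite big_ord1 divfK.
Qed.

Lemma affine_noetherian (k : fieldType) (R : comAlgType k) : affine R -> noetherian R.
Proof.
move=> [s sT].
apply: (@noetherian_adjoin _ _ (idfun \o in_alg R) s); first exact: noetherian_field.
apply/seteqP; split=> // x _.
by apply: (@adjoin_affine _ _ _ idfun s s sT) => y; rewrite map_id.
Qed.

Section Zariski.
Variable K : fieldType.

(** For a subring [A], this is the notion of a Goldman domain (G-domain): inverting the single
    element [f] already gives the field of fractions. *)
Definition goldman (A : set K) :=
  exists2 f, A f /\ f != 0 & forall a, A a -> a != 0 ->
    exists n b, A b /\ a * b = f ^+ n.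

Section Base.
Variables (S : comNzRingType) (phi : {rmorphism S -> K}).

(** Transitivity of integrality: the coefficients of an equation over [S] are integral over [S']. *)
Lemma integral_range (S' : comNzRingType) (phi' : {rmorphism S' -> K}) z :
  (forall a, integralOver phi' (phi a)) -> integralOver phi z ->
  integralOver phi' z.
Proof.
move=> int' [p p_monic pz0]; apply: (integral_root_monic _ pz0).
  exact: monic_map.
by apply/integral_poly => i; rewrite coef_map; apply: int'.
Qed.

Lemma integral_eval x (p : {poly S}) : integralOver phi x ->
  integralOver phi (eval_morph phi x p).
Proof.
move=> intx; apply: integral_horner => //.
by apply/integral_poly => i; rewrite coef_map; apply: integral_id.
Qed.

Lemma integralX z n : integralOver phi z -> integralOver phi (z ^+ n).
Proof.
move=> intz; elim: n => [|n IH]; first exact: integral1.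
by rewrite exprS; apply: integral_mul.
Qed.

(** A monic equation of degree m + 1 for 1 / a, multiplied by a ^ m, gives 1 / a as a polynomial in
    a. *)
Lemma integralV_range a : integralOver phi (phi a)^-1 -> range phi (phi a)^-1.
Proof.
have [->|a0 [p p_monic /rootP pz0]] := eqVneq (phi a) 0.
  by move=> _; rewrite invr0; exists 0; rewrite ?rmorph0.
have pK_monic := monic_map phi p_monic.
have sp : size (map_poly phi p) = (size p).-1.+1.
  by rewrite prednK ?size_map_poly_id0 ?lt0n ?size_poly_eq0
    ?monic_neq0 ?(monicP p_monic) ?rmorph1 ?oner_neq0.
have /(congr1 (fun y => y * phi a ^+ (size p).-1)) := pz0.
move: pK_monic => /monicP; rewrite lead_coefE sp /= => lead1.
rewrite mul0r horner_coef sp big_ord_recr /= lead1 mul1r mulrDl -exprMn mulVf // expr1n.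
(* An equation of degree 0 would read 1 = 0. *)
case: (size p).-1 => [|m].
  by rewrite big_ord0 mul0r add0r => /eqP; rewrite oner_eq0.
move=> /(congr1 (fun y => y / phi a)); rewrite mul0r mulrDl mul1r => /eqP.
rewrite addrC addr_eq0 => /eqP ->.
exists (- \sum_(i < m.+1) p`_i * a ^+ (m - i)) => //.
rewrite rmorphN rmorph_sum !mulr_suml; congr (- _); apply: eq_bigr => i _.
have lei : (i <= m)%N by rewrite -ltnS.
rewrite coef_map rmorphM rmorphXn -!mulrA; congr (_ * _).
have -> : phi a ^+ m.+1 = phi a ^+ (m - i) * phi a ^+ i * phi a.
  by rewrite -exprD subnK // exprSr.
by rewrite mulfK // exprVn mulrCA mulVf ?expf_neq0 // mulr1.
Qed.

(** Since [z] is nonzero, factors ['X] can be divided out until the constant coefficient has nonzero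
    image. *)
Lemma root_nonzero_const z (p : {poly S}) : z != 0 ->
  map_poly phi p != 0 -> eval_morph phi z p = 0 ->
  exists r c, phi c != 0 /\ phi c + eval_morph phi z r * z = 0.
Proof.
move=> z0; elim/poly_ind: p => [|p c IH]; first by rewrite rmorph0 eqxx.
rewrite rmorphD rmorphM /= map_polyX map_polyC.
rewrite /= rmorphD rmorphM /= eval_morphC eval_morphX.
have [->|c0] := eqVneq (phi c) 0; last first.
  by move=> _ pc0; exists p, c; split=> //; rewrite addrC.
rewrite polyC0 !addr0 mulf_eq0 negb_or => /andP[p0 _] /eqP.
by rewrite mulf_eq0 (negbTE z0) orbF => /eqP; apply: IH p0.
Qed.

Lemma eval_inv_denominator c p : phi c != 0 ->
  exists n g, eval_morph phi (phi c)^-1 p * phi c ^+ n = phi g.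
Proof.
move=> c0; elim/poly_ind: p => [|p d [n [g gE]]].
  by exists 0, 0; rewrite !rmorph0 mul0r.
exists n.+1, (g + d * c ^+ n.+1).
rewrite !rmorphD !rmorphM /= eval_morphC eval_morphX mulrDl rmorphXn -gE.
by rewrite exprS -!mulrA; congr (_ * _ + _); rewrite mulrCA mulVKf.
Qed.

End Base.

(** If [x] were transcendental, 1 + X p would divide a power of p, to which it is coprime. It would
    then be constant, which is impossible for nonzero p. *)
Lemma goldman_algebraic (S : comNzRingType) (phi : {rmorphism S -> K}) x :
  goldman (range (eval_morph phi x)) ->
  exists2 p : {poly S}, map_poly phi p != 0 & eval_morph phi x p = 0.
Proof.
move=> [_ [[p _ <-] p0] gold]; apply: contrapT => transc.
have {}transc q : eval_morph phi x q = 0 -> map_poly phi q = 0.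
  by move=> q0; apply/eqP/negPn/negP => ?; apply: transc; exists q.
pose P := map_poly phi p; pose a : {poly S} := 1 + 'X * p.
have mapa : map_poly phi a = 1 + 'X * P.
  by rewrite rmorphD rmorphM rmorph1 /= map_polyX.
have nza : map_poly phi a != 0.
  rewrite mapa; apply/eqP => /polyP/(_ 0)/eqP.
  by rewrite coefD coef1 coefXM addr0 coef0 oner_eq0.
have nzax : eval_morph phi x a != 0.
  by apply/eqP => /transc/eqP; rewrite (negbTE nza).
have [|n [_ [[b _ <-] abE]]] := gold _ _ nzax; first by exists a.
have {}abE : map_poly phi a * map_poly phi b = P ^+ n.
  rewrite -rmorphM -rmorphXn; apply/eqP; rewrite -subr_eq0 -rmorphB; apply/eqP.
  by apply: transc; rewrite rmorphB rmorphM rmorphXn abE subrr.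
have cop : coprimep (1 + 'X * P) (P ^+ n).
  apply: coprimep_expr; rewrite coprimep_sym -[1 + _]addrC.
  by rewrite coprimep_addl_mul coprimep1.
have /size_poly1P[e e0] : size (1 + 'X * P) == 1%N.
  by rewrite -coprimepp; apply: coprimep_dvdl cop; rewrite -abE -mapa dvdp_mulr.
have P0 : P != 0.
  by apply: contraNneq p0 => P0; rewrite -[eval_morph _ _ _]/(P.[x]) P0 horner0.
move=> /(congr1 (fun q : {poly K} => size (q - 1))).
rewrite addrC addKr mulrC size_mulX // => /eqP.
rewrite -polyC1 -polyCB size_polyC.
have := size_poly_eq0 P; rewrite (negbTE P0).
by case: (size P) => // m _; case: (_ != 0).
Qed.

(* With [c] the leading coefficient of an equation for [x] and [e] the constant
   coefficient of one for [f], the elements of [S[x]] and [1 / f] are integral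
   over [S[1 / (c e)]]. So is then [1 / a] for [a] nonzero in [S], which puts it
   in [S[1 / (c e)]]. *)
Lemma goldman_descent (S : comNzRingType) (phi : {rmorphism S -> K}) x :
  goldman (range (eval_morph phi x)) -> goldman (range phi).
Proof.
move=> gold; have [q q0 qx0] := goldman_algebraic gold.
have [_ [[p _ <-] f0] {}gold] := gold; set f := eval_morph phi x p in f0 gold.
set Q := map_poly phi q in q0.
pose c := q`_(size Q).-1; have c0 : phi c != 0.
  by rewrite /c -coef_map -lead_coefE lead_coef_eq0.
(* The range of [L h] is S[1 / h]. *)
pose L h := eval_morph phi (phi h)^-1.
have intL h a : integralOver (L h) (phi a).
  by rewrite -(eval_morphC phi (phi h)^-1); apply: integral_id.
have intLV h : integralOver (L h) (phi h)^-1.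
  by rewrite -[X in integralOver _ X](eval_morphX phi (phi h)^-1); apply: integral_id.
have intx : integralOver (L c) x.
  apply: (@integral_root_monic _ _ _ _ ((phi c)^-1 *: Q)).
  - by rewrite monicE lead_coefZ lead_coefE coef_map mulVf.
  - by rewrite rootE hornerZ [Q.[x]]qx0 mulr0.
  - apply/integral_poly => i.
    by rewrite coefZ coef_map; apply: integral_mul; [exact: intLV|exact: intL].
have intB (b : {poly S}) : integralOver (L c) (eval_morph phi x b).
  apply: integral_horner => //.
  by apply/integral_poly => i; rewrite coef_map; exact: intL.
have [m m_monic mf0] := intB p.
have mK0 : map_poly (L c) m != 0 by rewrite monic_neq0 // monic_map.
have [r [d [d0 drE]]] := @root_nonzero_const {poly S} (L c) f m f0 mK0 (rootP mf0).
have [N [e eE]] := eval_inv_denominator d c0.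
have e0 : phi e != 0 by rewrite -eE mulf_neq0 // expf_neq0.
pose h := c * e; have h0 : phi h != 0 by rewrite rmorphM mulf_neq0.
have {}intLV : integralOver (L h) (phi c)^-1 /\ integralOver (L h) (phi e)^-1.
  have hE : phi h = phi c * phi e by rewrite rmorphM.
  split; [rewrite (_ : _^-1 = phi e / phi h)|rewrite (_ : _^-1 = phi c / phi h)];
    try exact: integral_mul.
    by rewrite hE invfM mulrCA divff // mulr1.
  by rewrite hE invfM mulVKf.
have intLch z : integralOver (L c) z -> integralOver (L h) z.
  apply: integral_range => a; apply: integral_horner; last by case: intLV.
  by apply/integral_poly => i; rewrite coef_map; exact: intL.
have intfV : integralOver (L h) f^-1.
  (* The equation for [f] has the nonzero constant term [L c d], equal to e / c ^ N, and is solved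
     for 1 / f. *)
  have -> : f^-1 = - (phi c ^+ N * (phi e)^-1 * eval_morph (L c) f r).
    apply: (mulIf f0); rewrite mulVf // mulNr -[X in - X]mulrA.
    move/eqP: drE; rewrite addrC addr_eq0 => /eqP ->.
    rewrite mulrN opprK -eE; have := expf_neq0 N c0; move: (phi c ^+ N) => v v0.
    by move: (L c d) d0 => u u0; field; rewrite u0 v0.
  apply: integral_opp; apply: integral_mul.
    by apply: integral_mul; [exact: integralX|case: intLV].
  by apply: intLch; apply: integral_eval; exact: intB.
exists (phi h); first by split=> //; exists h.
move=> _ [a _ <-] a0; have [|n [_ [[b _ <-] abE]]] := gold _ _ a0.
  by exists a%:P; rewrite // eval_morphC.
have [|g _ gE] := @integralV_range {poly S} (L h) a%:P.
  rewrite eval_morphC (_ : _^-1 = eval_morph phi x b * f^-1 ^+ n).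
    by apply: integral_mul; [apply: intLch|exact: integralX].
  by apply: (mulfI a0); rewrite mulrA abE mulfV // exprVn mulfV // expf_neq0.
(* The inverse of [phi a] lies in S[1 / h]; clearing powers of [h] gives a cofactor in the range of
   [phi]. *)
have [M [g' g'E]] := eval_inv_denominator g h0.
exists M, (phi g'); split; first by exists g'.
by rewrite -g'E [eval_morph _ _ g]gE eval_morphC mulVKf.
Qed.

Lemma goldman_adjoin (S : comNzRingType) (phi : {rmorphism S -> K}) xs :
  goldman (adjoin phi xs) -> goldman (range phi).
Proof.
elim: xs S phi => [//|x xs IH] S phi /= /IH; apply: goldman_descent.
Qed.

(** Descent strips off [xs] and leaves S[x] a Goldman domain. The conclusion concerns the head of
    the list, where any element of interest can be placed. *)
Lemma goldman_adjoin_algebraic (S : comNzRingType) (phi : {rmorphism S -> K}) x xs :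
  goldman (adjoin phi (x :: xs)) ->
  exists2 p : {poly S}, map_poly phi p != 0 & eval_morph phi x p = 0.
Proof. by move=> /= /goldman_adjoin; exact: goldman_algebraic. Qed.

End Zariski.

(** * Derivations of fraction fields *)

Section FracOf.
Local Open Scope quotient_scope.

Lemma fraction_repr (D : idomainType) (z : {fraction D}) :
  z = FracField.tofrac \n_(repr z) / FracField.tofrac \d_(repr z).
Proof.
have dz0 : FracField.tofrac \d_(repr z) != 0 by rewrite tofrac_eq0 denom_ratioP.
apply: (mulIf dz0); rewrite divfK // -{1}[z]reprK.
unlock FracField.tofrac; rewrite -[LHS]FracField.pi_mul; apply/eqmodP.
rewrite /= FracField.equivfE /FracField.mulf /=.
by rewrite !numden_Ratio ?mulf_neq0 ?denom_ratioP ?oner_neq0 // !mulr1 mulrC.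
Qed.

Variables (R : comNzRingType) (P : set R) (primeP : prime_ideal P).

Definition frac_of : {rmorphism R -> fract primeP} :=
  (@FracField.tofrac _ : {rmorphism residue_ring primeP -> fract primeP})
  \o (\pi_(residue_ring primeP) : {rmorphism R -> residue_ring primeP}).

Lemma frac_ofE x : frac_of x = FracField.tofrac (residue primeP x).
Proof. by []. Qed.

Lemma frac_of_eq0 x : frac_of x = 0 <-> P x.
Proof.
rewrite frac_ofE; split=> [/eqP|Px].
  rewrite tofrac_eq0 -(rmorph0 (\pi_(residue_ring primeP))) /residue.
  by rewrite -Quotient.idealrBE subr0 => /asboolP.
apply/eqP; rewrite tofrac_eq0 -(rmorph0 (\pi_(residue_ring primeP))) /residue.
by rewrite -Quotient.idealrBE subr0; apply/asboolP.
Qed.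

Lemma frac_of_neq0 x : frac_of x != 0 <-> ~ P x.
Proof.
split=> [/eqP x0 /frac_of_eq0//|nPx]; apply/eqP => /frac_of_eq0; exact: nPx.
Qed.

Lemma frac_of_eq x y : frac_of x = frac_of y <-> P (x - y).
Proof.
rewrite -frac_of_eq0 rmorphB; split=> [->|/eqP]; first by rewrite subrr.
by rewrite subr_eq0 => /eqP.
Qed.

Lemma frac_of_surj (z : fract primeP) :
  exists x y, ~ P y /\ z = frac_of x / frac_of y.
Proof.
exists (repr \n_(repr z)), (repr \d_(repr z)).
rewrite -frac_of_neq0 !frac_ofE /residue !reprK -fraction_repr; split=> //.
by rewrite tofrac_eq0 denom_ratioP.
Qed.

End FracOf.

Section Derivations.
Variables (k : fieldType) (R : comAlgType k) (d : R -> R).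
Hypothesis der_d : derivation d.

Lemma derD x y : d (x + y) = d x + d y.
Proof. by have [lin_d _] := der_d; rewrite -[x]scale1r lin_d !scale1r. Qed.

Lemma derM x y : d (x * y) = d x * y + x * d y.
Proof. by case: der_d. Qed.

Lemma der0 : d 0 = 0.
Proof. by apply: (addrI (d 0)); rewrite -derD !addr0. Qed.

Lemma derZ c x : d (c *: x) = c *: d x.
Proof. by have [lin_d _] := der_d; rewrite -[c *: x]addr0 lin_d der0 addr0. Qed.

Lemma derB x y : d (x - y) = d x - d y.
Proof. by rewrite derD -scaleN1r derZ scaleN1r. Qed.

Lemma der1 : d 1 = 0.
Proof. by apply: (addrI (d 1)); rewrite -{3}[1]mulr1 derM mulr1 mul1r addr0. Qed.

Lemma der_alg (c : k) : d c%:A = 0.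
Proof. by rewrite derZ der1 scaler0. Qed.

Lemma derXS x n : d (x ^+ n.+1) = (x ^+ n * d x) *+ n.+1.
Proof.
elim: n => [|n IH]; first by rewrite expr0 mul1r expr1.
by rewrite exprS derM IH mulrnAr mulrA -exprS [d x * _]mulrC -mulrS.
Qed.

Lemma der_sum (T : Type) (s : seq T) (F : T -> R) :
  d (\sum_(i <- s) F i) = \sum_(i <- s) d (F i).
Proof. exact: (big_morph d derD der0). Qed.

End Derivations.

Section QuotientRule.
Variable F : fieldType.
Implicit Types X Y U V : F.

(** The last hypothesis is the derivative of N Y = X M, so the quotient rule gives the same value on
    two representations of a fraction. *)
Lemma quotient_rule_wd (N M X Y N' M' X' Y' : F) : M != 0 -> Y != 0 ->
  N / M = X / Y -> N' * Y + N * Y' = X' * M + X * M' ->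
  (N' * M - N * M') / M ^+ 2 = (X' * Y - X * Y') / Y ^+ 2.
Proof.
move=> M0 Y0 /(congr1 (fun w => w * M)); rewrite divfK // => -> /esym/eqP.
rewrite -subr_eq => /eqP dE.
have -> : N' = (X' * M + X * M' - X / Y * M * Y') / Y by rewrite dE mulfK.
by field; rewrite Y0 M0.
Qed.

Lemma quotient_ruleD X Y U V X' Y' U' V' : Y != 0 -> V != 0 ->
  ((X' * V + X * V' + (U' * Y + U * Y')) * (Y * V) -
     (X * V + U * Y) * (Y' * V + Y * V')) / (Y * V) ^+ 2 =
  (X' * Y - X * Y') / Y ^+ 2 + (U' * V - U * V') / V ^+ 2.
Proof. by move=> Y0 V0; field; rewrite Y0 V0. Qed.

Lemma quotient_ruleM X Y U V X' Y' U' V' : Y != 0 -> V != 0 ->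
  ((X' * U + X * U') * (Y * V) - X * U * (Y' * V + Y * V')) / (Y * V) ^+ 2 =
  (X' * Y - X * Y') / Y ^+ 2 * (U / V) + X / Y * ((U' * V - U * V') / V ^+ 2).
Proof. by move=> Y0 V0; field; rewrite Y0 V0. Qed.

End QuotientRule.

Section FractDer.
Variables (k : fieldType) (R : comAlgType k) (P : set R) (primeP : prime_ideal P).
Variables (d : R -> R) (der_d : derivation d) (dP : forall x, P x -> P (d x)).
Local Notation f := (frac_of primeP).

(** Frees [fract_der] from the chosen representatives. The relation between two representations
    holds in [R] modulo [P], and [dP] allows differentiating it. *)
Lemma fract_derE x y : ~ P y ->
  fract_der d (f x / f y) = (f (d x) * f y - f x * f (d y)) / f y ^+ 2.
Proof.
move=> /(frac_of_neq0 primeP) fy0.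
have [n [m [fm0 E ->]]] : exists n m, [/\ f m != 0, f n / f m = f x / f y &
    fract_der d (f x / f y) = (f (d n) * f m - f n * f (d m)) / f m ^+ 2].
  move: (f x / f y) => z; exists (repr \n_(repr z)), (repr \d_(repr z)).
  have nE : f (repr \n_(repr z)) = FracField.tofrac \n_(repr z).
    by rewrite frac_ofE /residue reprK.
  have mE : f (repr \d_(repr z)) = FracField.tofrac \d_(repr z).
    by rewrite frac_ofE /residue reprK.
  split; first by rewrite mE tofrac_eq0 denom_ratioP.
    by rewrite nE mE -fraction_repr.
  by rewrite /fract_der rmorphXn rmorphB !rmorphM /= -nE -mE.
apply: (quotient_rule_wd fm0 fy0 E).
rewrite -!rmorphM -!rmorphD -!(derM der_d).
apply/(frac_of_eq primeP); rewrite -(derB der_d); apply: dP.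
apply/(frac_of_eq primeP); rewrite !rmorphM; apply/eqP.
by have /eqP := E; rewrite (eqr_div _ _ fm0 fy0).
Qed.

End FractDer.

Section FractionField.
Variables (k : fieldType) (R : comAlgType k) (F : fieldType).
Variables (f : {rmorphism R -> F}) (P : set R) (d : R -> R) (D : F -> F).
Hypothesis kerf : forall x, f x = 0 <-> P x.
Hypothesis surjf : forall z, exists x y, f y != 0 /\ z = f x / f y.
Hypothesis der_d : derivation d.
Hypothesis DE : forall x y, f y != 0 ->
  D (f x / f y) = (f (d x) * f y - f x * f (d y)) / f y ^+ 2.

Lemma frac_der_base x : D (f x) = f (d x).
Proof.
have := @DE x 1; rewrite rmorph1 divr1 => -> //; last exact: oner_neq0.
by rewrite (der1 der_d) rmorph0 mulr0 subr0 mulr1 expr1n divr1.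
Qed.

Lemma frac_derD z w : D (z + w) = D z + D w.
Proof.
have [x [y [y0 ->]]] := surjf z; have [u [v [v0 ->]]] := surjf w.
have -> : f x / f y + f u / f v = f (x * v + u * y) / f (y * v).
  by rewrite addf_div // rmorphD !rmorphM.
rewrite !DE ?rmorphM ?mulf_neq0 // -quotient_ruleD //.
by rewrite (derD der_d) !(derM der_d) !(rmorphD, rmorphM).
Qed.

Lemma frac_derM z w : D (z * w) = D z * w + z * D w.
Proof.
have [x [y [y0 ->]]] := surjf z; have [u [v [v0 ->]]] := surjf w.
have -> : (f x / f y) * (f u / f v) = f (x * u) / f (y * v).
  by rewrite mulf_div !rmorphM.
rewrite !DE ?rmorphM ?mulf_neq0 // -quotient_ruleM //.
by rewrite !(derM der_d) !(rmorphD, rmorphM).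
Qed.

Lemma frac_derV z : D z = 0 -> D z^-1 = 0.
Proof.
have [->|z0 Dz0] := eqVneq z 0; first by rewrite invr0.
have := frac_derM z z^-1; rewrite mulfV // Dz0 mul0r add0r.
rewrite -{1}(rmorph1 f) frac_der_base (der1 der_d) rmorph0 => /esym/eqP.
by rewrite mulf_eq0 (negbTE z0) => /eqP.
Qed.

Lemma frac_der_poly (p : {poly k}) z : D z = 0 ->
  D (map_poly (f \o in_alg R) p).[z] = 0.
Proof.
move=> Dz0; elim/poly_ind: p => [|p c IH].
  by rewrite rmorph0 horner0 -(rmorph0 f) frac_der_base (der0 der_d) rmorph0.
rewrite rmorphD rmorphM /= map_polyX map_polyC hornerMXaddC.
rewrite frac_derD frac_derM IH mul0r Dz0 mulr0 !add0r.
by rewrite [LHS](frac_der_base c%:A) (der_alg der_d) rmorph0.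
Qed.

End FractionField.

(** * Equations for algebraic fractions *)

Section Algebraic.
Variables (k : fieldType) (R : comAlgType k).

(* [y] collects the terms of [b ^+ m * p.[a / b]] that are multiples of [b]. *)
Lemma algebraic_ratio (F : fieldType) (psi : {rmorphism R -> F}) (a b : R) :
  psi b != 0 -> algebraicOver (psi \o in_alg R) (psi a / psi b) ->
  exists m y, psi (a ^+ m + b * y) = 0.
Proof.
move=> b0 [p p0 /rootP]; set p' := map_poly _ p => paE.
have spE : size p' = (size p).-1.+1 by rewrite size_map_poly prednK // size_poly_gt0.
move: paE; rewrite horner_coef spE big_ord_recr /= => paE.
set m := (size p).-1 in paE.
have c0 : lead_coef p != 0 by rewrite lead_coef_eq0.
exists m, ((lead_coef p)^-1 *: \sum_(i < m) (p`_i *: (a ^+ i * b ^+ (m - i.+1)))).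
have inner : psi (lead_coef p *: (a ^+ m + b * ((lead_coef p)^-1 *:
    \sum_(i < m) (p`_i *: (a ^+ i * b ^+ (m - i.+1)))))) = 0.
  rewrite scalerDr -scalerAr scalerA divff // scale1r.
  move/(congr1 (fun w => w * psi b ^+ m)): paE; rewrite mul0r mulrDl => paE.
  rewrite addrC rmorphD -[RHS]paE; congr (_ + _); last first.
    by rewrite -mulr_algl rmorphM rmorphXn -mulrA exprMn exprVn divfK
      ?expf_neq0 // coef_map lead_coefE.
  rewrite rmorphM rmorph_sum mulr_sumr mulr_suml; apply: eq_bigr => i _.
  rewrite -mulr_algl !rmorphM !rmorphXn coef_map mulrCA -!mulrA; congr (_ * _).
  rewrite exprMn exprVn -mulrA mulrCA; congr (_ * _).
  have -> : psi b ^+ m = psi b ^+ (m - i.+1) * (psi b * psi b ^+ i).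
    by rewrite -exprS -exprD subnK.
  by rewrite mulrC -[LHS](mulKf (expf_neq0 i b0)); congr (_ * _); ring.
move: inner; rewrite -mulr_algl rmorphM => /eqP; rewrite mulf_eq0.
by rewrite [psi _ == 0](fmorph_eq0 (psi \o in_alg R)) (negbTE c0) => /eqP.
Qed.

(** The ratio 1 / x is algebraic too, and its cleared equation has leading term 1 and all other
    terms divisible by x. *)
Lemma algebraic_inverse (F : fieldType) (psi : {rmorphism R -> F}) (x : R) :
  psi x != 0 -> algebraicOver (psi \o in_alg R) (psi x) ->
  exists y, psi (1 + x * y) = 0.
Proof.
move=> x0 /algebraic_inv algx.
have [|m [y E]] := @algebraic_ratio F psi 1 x x0; first by rewrite rmorph1 div1r.
by exists y; rewrite expr1n in E.
Qed.

End Algebraic.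

(** * The Jacobson property *)

Section Zorn.
Variable R : comNzRingType.
Implicit Types I P N M : set R.

Lemma ideal_mulr I x y : ideal I -> I x -> I (x * y).
Proof. by move=> [_ _ IM] Ix; rewrite mulrC; apply: IM. Qed.

Lemma ideal_mul_sub I J Q : ideal Q ->
  (forall x y, I x -> J y -> Q (x * y)) -> ideal_mul I J `<=` Q.
Proof.
by move=> idQ IJQ; apply: smallest_sub => // _ [x Ix [y Jy ->]]; apply: IJQ.
Qed.

Lemma ideal_adjoin I x : ideal I ->
  ideal [set y | exists a r, I a /\ y = a + r * x].
Proof.
move=> [I0 ID IM]; split.
- by exists 0, 0; rewrite mul0r addr0.
- move=> _ _ [a [r [Ia ->]]] [b [s [Ib ->]]]; exists (a + b), (r + s).
  by split; [exact: ID | rewrite mulrDl addrACA].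
- move=> c _ [a [r [Ia ->]]]; exists (c * a), (c * r).
  by split; [exact: IM | rewrite mulrDr mulrA].
Qed.

(** [N] is maximal among the ideals above [P] that avoid the powers of [f]. For [x] outside [N], the
    ideal generated by [N] and [x] meets these powers; this gives both primality and the Goldman
    property of R / N. *)
Lemma prime_avoiding P f : ideal P -> (forall n, ~ P (f ^+ n)) ->
  exists N, [/\ prime_ideal N, P `<=` N, ~ N f &
    forall x, ~ N x -> exists n y, N (x * y - f ^+ n)].
Proof.
move=> idP Pf.
pose T A := A = set0 \/ [/\ ideal A, P `<=` A & forall n, ~ A (f ^+ n)].
have [N [TN maxN]] : exists A, T A /\ forall B, A `<` B -> ~ T B.
  apply: Zorn_bigcup => C CT totC.
  have [C0|] := EM (forall X, C X -> X = set0).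
    left; apply/seteqP; split=> // x [X CX Xx].
    by rewrite -(C0 X CX).
  move=> /existsNP[X0 /not_implyP[CX0 X0n0]]; right.
  have CT' X x : C X -> X x -> [/\ ideal X, P `<=` X & forall n, ~ X (f ^+ n)].
    by move=> CX Xx; have [XE|//] := CT X CX; rewrite XE in Xx.
  have [//|[idX0 PX0 _]] := CT X0 CX0.
  split; first split.
  - by exists X0 => //; case: idX0.
  - move=> x y [X CX Xx] [Y CY Yy].
    have [XY|YX] := totC X Y CX CY.
      by exists Y => //; have [[_ D _] _ _] := CT' _ _ CY Yy; apply: D => //; apply: XY.
    by exists X => //; have [[_ D _] _ _] := CT' _ _ CX Xx; apply: D => //; apply: YX.
  - move=> a x [X CX Xx]; exists X => //.
    by have [[_ _ M] _ _] := CT' _ _ CX Xx; apply: M.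
  - by move=> x Px; exists X0 => //; apply: PX0.
  - by move=> n [X CX Xf]; have [_ _] := CT' _ _ CX Xf; apply; exact: Xf.
case: TN => [N0|[idN PN Nf]].
  exfalso; apply: (maxN P); last by right; split.
  by rewrite N0; split=> // sub; have [P0 _ _] := idP; exact: sub P0.
have pow x : ~ N x -> exists n y, N (x * y - f ^+ n).
  move=> nNx; apply: contrapT => H.
  pose B : set R := [set y | exists a r, N a /\ y = a + r * x].
  have NB : N `<=` B by move=> a Na; exists a, 0; rewrite mul0r addr0.
  apply: (maxN B).
    split=> // BN; apply: nNx; apply: BN; exists 0, 1.
    by rewrite mul1r add0r; split=> //; case: idN.
  right; split; [exact: ideal_adjoin|exact: subset_trans NB|].
  move=> n [a [r [Na fE]]]; apply: H; exists n, r.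
  by rewrite fE mulrC opprD addrCA subrr addr0; apply: idealN.
exists N; split=> //; last by have := Nf 1.
split=> //; first by have := Nf 0.
move=> x y Nxy; apply: contrapT => /not_orP[/pow[n [s xs]] /pow[m [t yt]]].
have [_ ND NM] := idN; apply: (Nf (n + m)%N).
have -> : f ^+ (n + m) = x * y * (s * t) +
   - ((x * s - f ^+ n) * (y * t)) + - (f ^+ n * (y * t - f ^+ m)).
  by rewrite exprD; ring.
apply: (ND); last by apply: idealN => //; apply: NM.
by apply: (ND); [exact: ideal_mulr|apply: idealN => //; exact: ideal_mulr].
Qed.

Lemma maximal_inverse M x : maximal_ideal M -> ~ M x -> exists r, M (1 - r * x).
Proof.
move=> [idM _ maxM] nMx; have [M0 _ _] := idM.
pose B : set R := [set y | exists a r, M a /\ y = a + r * x].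
have MB : M `<=` B by move=> a Ma; exists a, 0; rewrite mul0r addr0.
have [E|E] := maxM B (ideal_adjoin x idM) MB.
  by case: nMx; rewrite -E; exists 0, 1; rewrite mul1r add0r.
have [a [r [Ma ->]]] : B 1 by rewrite E.
by exists r; rewrite addrK.
Qed.

Lemma maximal_prime M : maximal_ideal M -> prime_ideal M.
Proof.
move=> maxM; have [idM MT _] := maxM; have [_ MD MM] := idM.
split=> // [/(ideal_setT idM)//|x y Mxy].
apply: contrapT => /not_orP[/(maximal_inverse maxM)[r Mr]]; apply.
rewrite -[y](subrK (r * (x * y))); apply: MD; last exact: MM.
by rewrite mulrA -{1}[y]mul1r -mulrBl; apply: ideal_mulr.
Qed.

End Zorn.

Section Nullstellensatz.
Variables (k : fieldType) (R : comAlgType k).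

Lemma adjoin_sub_range (T S S' : comNzRingType) (psi : {rmorphism S' -> T})
    (phi : {rmorphism S -> T}) xs :
  (forall a, range psi (phi a)) -> (forall x, x \in xs -> range psi x) ->
  adjoin phi xs `<=` range psi.
Proof.
elim: xs S phi => [|x xs IH] S phi phiP xsP /=; first by move=> _ [a _ <-].
apply: IH => [p|y ys]; last by apply: xsP; rewrite inE ys orbT.
have [b _ bE] : range psi x by apply: xsP; rewrite mem_head.
elim/poly_ind: p => [|p c [q _ qE]]; first by exists 0; rewrite ?rmorph0.
have [e _ eE] := phiP c; exists (q * b + e) => //.
by rewrite !rmorphD !rmorphM /= eval_morphC eval_morphX qE bE eE.
Qed.

(* Zariski's lemma, in the generality needed for the Jacobson property. *)
Lemma affine_goldman_algebraic (F : fieldType) (psi : {rmorphism R -> F}) g :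
  affine R -> psi g != 0 ->
  (forall x, psi x != 0 -> exists n y, psi (x * y) = psi g ^+ n) ->
  forall x, algebraicOver (psi \o in_alg R) (psi x).
Proof.
move=> [s sT] g0 gold x.
(* Redundant as a generator, [psi x] is put first so that it is the element shown to be
   algebraic. *)
pose ys := psi x :: map psi s.
have adj y : adjoin (psi \o in_alg R) ys (psi y).
  by apply: adjoin_affine sT _ _ => z zs; rewrite inE zs orbT.
have [|p p0 px0] := @goldman_adjoin_algebraic F k (psi \o in_alg R) (psi x) (map psi s).
  exists (psi g); first by split=> //; exact: adj.
  move=> a /(@adjoin_sub_range F k R psi) [].
  - by move=> c; exists c%:A.
  - move=> z; rewrite inE => /predU1P[->|/mapP[w _ ->]]; first by exists x.
    by exists w.
  move=> a' _ <- /gold[n [y E]]; exists n, (psi y); split; first exact: adj.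
  by rewrite -rmorphM.
by exists p; [apply: contraNneq p0 => ->; rewrite rmorph0|exact/rootP].
Qed.

(** R / N is a Goldman domain, so its elements are algebraic over [k], and the nonzero ones are
    invertible already in R / N. *)
Lemma goldman_maximal (N : set R) f : affine R -> prime_ideal N -> ~ N f ->
  (forall x, ~ N x -> exists n y, N (x * y - f ^+ n)) -> maximal_ideal N.
Proof.
move=> affR primeN Nf gold; have [idN N1 _] := primeN.
split=> // [NT|I idI NI]; first by apply: N1; rewrite NT.
have [IN|/existsNP[x /not_implyP[Ix nNx]]] := EM (I `<=` N).
  by left; apply/seteqP.
right; apply: ideal_setT => //.
have fx0 : frac_of primeN x != 0 by apply/frac_of_neq0.
have algx : algebraicOver (frac_of primeN \o in_alg R) (frac_of primeN x).
  apply: (affine_goldman_algebraic affR (g := f)); first exact/frac_of_neq0.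
  move=> y /frac_of_neq0/gold[n [z Nyz]]; exists n, z; rewrite -rmorphXn.
  exact/frac_of_eq.
have [y] := algebraic_inverse fx0 algx.
move=> /frac_of_eq0/NI I1xy; rewrite -[1](addrK (x * y)).
by apply: idealB => //; apply: ideal_mulr.
Qed.

(** An ideal above [P] maximal among those avoiding the powers of [f] is a maximal ideal. *)
Lemma jacobson (P : set R) f : affine R -> prime_ideal P -> ~ P f ->
  exists M, [/\ maximal_ideal M, P `<=` M & ~ M f].
Proof.
move=> affR [idP P1 prP] Pf.
have Pfn n : ~ P (f ^+ n).
  by elim: n => [//|n IH]; rewrite exprS => /prP[].
have [N [primeN PN Nf gold]] := prime_avoiding idP Pfn.
by exists N; split=> //; apply: goldman_maximal affR primeN Nf gold.
Qed.

(** R / M is a Goldman domain with [g := 1], since each nonzero element divides 1. *)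
Lemma maximal_algebraic (M : set R) : affine R -> maximal_ideal M ->
  forall x, exists2 p : {poly k}, p != 0 &
    M (map_poly (in_alg R) p).[x].
Proof.
move=> affR maxM x; have primeM := maximal_prime maxM.
have [idM M1 _] := primeM.
have [p p0 /rootP px0] : algebraicOver (frac_of primeM \o in_alg R) (frac_of primeM x).
  apply: (affine_goldman_algebraic affR (g := 1)).
    by rewrite rmorph1 oner_neq0.
  move=> y /frac_of_neq0 nMy; exists 0.
  have [r Mr] := maximal_inverse maxM nMy.
  exists r; rewrite expr0 -(rmorph1 (frac_of primeM)); apply/frac_of_eq.
  by rewrite -opprB mulrC; apply: idealN.
exists p => //; apply/(frac_of_eq0 primeM).
by rewrite -horner_map -map_poly_comp.
Qed.

End Nullstellensatz.

(** * Delta-prime ideals *)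

Section DeltaPrime.
Variables (k : fieldType) (R : comAlgType k) (Delta : set (R -> R)).
Hypothesis char0 : [pchar k] =i pred0.
Hypothesis derDelta : Delta `<=` (@derivation k R).
Implicit Types (I M P Q : set R).

Lemma ideal_natmul I x n : ideal I -> I (x *+ n.+1) -> I x.
Proof.
move=> [_ _ IM] Ixn; have n0 : n.+1%:R != 0 :> k by have /pcharf0P -> := char0.
have -> : x = (n.+1%:R^-1)%:A * (x *+ n.+1).
  by rewrite mulr_algl -scaler_nat scalerA mulVf // scale1r.
exact: IM.
Qed.

(** The extra factor [x] avoids the exponent n - 1, so that n = 0 is no exception. *)
Lemma derX_mul (d : R -> R) x n : @derivation k R d ->
  d (x ^+ n) * x = (x ^+ n * d x) *+ n.
Proof.
move=> der_d; case: n => [|n]; first by rewrite expr0 (der1 der_d) mul0r.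
by rewrite (derXS der_d) mulrnAl mulrAC -exprSr.
Qed.

(** Differentiating x ^ (m + 1) (d x) ^ j and multiplying by d x trades one factor x for two factors
    d x, up to the integer m + 1, invertible in characteristic 0. After n trades no x is left. *)
Lemma derivative_nilpotent Q d x n : dideal Delta Q -> Delta d ->
  Q (x ^+ n) -> Q (d x ^+ n.*2).
Proof.
move=> [idQ stQ] Dd Qxn; have der_d := derDelta Dd.
have step m j : Q (x ^+ m.+1 * d x ^+ j) -> Q (x ^+ m * d x ^+ j.+2).
  move=> Qmj; apply: (@ideal_natmul _ _ m idQ).
  have -> : (x ^+ m * d x ^+ j.+2) *+ m.+1 =
      d (x ^+ m.+1 * d x ^+ j) * d x - x ^+ m.+1 * d x ^+ j * d (d x) *+ j.
    rewrite (derM der_d) mulrDl -[x ^+ m.+1 * _ * d x]mulrA (derX_mul _ _ der_d).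
    rewrite mulrnAr [x ^+ m.+1 * (_ * _)]mulrA addrK (derXS der_d) !mulrnAl.
    by congr (_ *+ _); rewrite !exprS; ring.
  apply: idealB => //; first by apply: ideal_mulr => //; apply: stQ.
  by rewrite -mulr_natr; apply: ideal_mulr => //; apply: ideal_mulr.
suff H i : (i <= n)%N -> Q (x ^+ (n - i) * d x ^+ i.*2).
  by have := H n (leqnn n); rewrite subnn mul1r.
elim: i => [_|i IH ltin]; first by rewrite subn0 mulr1.
by rewrite doubleS; apply: step; rewrite -subSn // subSS; apply/IH/ltnW.
Qed.

Definition radical Q : set R := [set x | exists n, Q (x ^+ n)].

Lemma radical_dideal Q : dideal Delta Q -> dideal Delta (radical Q).
Proof.
move=> didQ; have [idQ _] := didQ; have [Q0 QD QM] := idQ.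
split; first split.
- by exists 1; rewrite expr1.
- move=> x y [n xn] [m ym]; exists (n + m)%N; rewrite exprDn; apply: ideal_sum => // i _.
  rewrite -mulr_natr; apply: ideal_mulr => //.
  case: (leqP m i) => [lemi|ltim].
    have -> : y ^+ i = y ^+ (i - m) * y ^+ m by rewrite -exprD subnK.
    by do 2!apply: (QM).
  apply: ideal_mulr => //.
  have len : (n <= n + m - i)%N by rewrite -addnBA ?leq_addr // ltnW.
  by rewrite -(subnK len) exprD; apply: (QM).
- by move=> a x [n xn]; exists n; rewrite exprMn; apply: (QM).
- by move=> d x Dd [n xn]; exists n.*2; exact: derivative_nilpotent didQ Dd xn.
Qed.

(** The radical has finitely many generators. They are treated in turn, multiplying [x] by the
    highest power of the generator that keeps it outside [Q]. *)
Lemma radical_annihilator Q : noetherian R -> ideal Q -> ~ Q 1 ->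
  exists x, ~ Q x /\ forall y, radical Q y -> Q (x * y).
Proof.
move=> noeR idQ Q1; have [_ QD QM] := idQ.
have [u [n [radu spanu]]] := noetherian_fg (radical Q) noeR.
suff [x [nQx xu]] : exists x, ~ Q x /\ forall i, (i < n)%N -> Q (x * u i).
  exists x; split=> // y /spanu[c ->]; rewrite mulr_sumr; apply: ideal_sum => // i _.
  by rewrite mulrCA; apply: (QM); apply: xu.
elim: {-2}n (leqnn n) => [_|m IH ltmn]; first by exists 1.
have [x [nQx xu]] := IH (ltnW ltmn).
have [e Qe] := radu m ltmn.
have exP : exists i, `[< Q (x * u m ^+ i) >] by exists e; apply/asboolP/(QM).
case: (ex_minnP exP) => -[/asboolP|i /asboolP Qi mini]; first by rewrite mulr1.
exists (x * u m ^+ i); split=> [Qxi|j].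
  by have /mini := asboolT Qxi; rewrite ltnn.
rewrite ltnS leq_eqVlt => /predU1P[->|ltj]; first by rewrite -mulrA -exprSr.
by rewrite mulrAC; apply: ideal_mulr => //; apply: xu.
Qed.

(** The colon ideal C = (Q : radical Q) is a Delta-ideal whose product with the radical lies in [Q],
    but C is not inside [Q] by the previous lemma. *)
Lemma dprime_radical Q : noetherian R -> dprime Delta Q -> radical Q `<=` Q.
Proof.
move=> noeR [didQ QT prQ]; have [idQ stQ] := didQ; have [Q0 QD QM] := idQ.
have [idN stN] := radical_dideal didQ.
have Q1 : ~ Q 1 by move=> /(ideal_setT idQ).
have [x [nQx xN]] := radical_annihilator noeR idQ Q1.
pose C : set R := [set y | forall a, radical Q a -> Q (y * a)].
have didC : dideal Delta C.
  split; first split.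
  - by move=> a _; rewrite mul0r.
  - by move=> y z Cy Cz a Na; rewrite mulrDl; apply: QD; [apply: Cy|apply: Cz].
  - by move=> b y Cy a Na; rewrite -mulrA; apply: (QM); apply: Cy.
  - move=> d y Dd Cy a Na; have der_d := derDelta Dd.
    rewrite -[d y * a](addrK (y * d a)) -(derM der_d).
    apply: idealB => //; first by apply: stQ => //; apply: Cy.
    by apply: Cy; apply: stN.
have [|CQ|//] := prQ C (radical Q) didC (conj idN stN).
  by apply: ideal_mul_sub => // y z Cy Nz; apply: Cy.
by case: nQx; apply: CQ.
Qed.

(** For x y in [Q], the colon ideals I = (Q : y), containing x, and K = (Q : I), containing y, are
    Delta-ideals with product in [Q]. *)
Lemma dprime_prime Q : noetherian R -> dprime Delta Q -> prime_ideal Q.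
Proof.
move=> noeR dprQ; have radQ := dprime_radical noeR dprQ.
have [[idQ stQ] QT prQ] := dprQ; have [Q0 QD QM] := idQ.
split=> // [/(ideal_setT idQ)//|x y Qxy].
(* The square of d a * b lies in [Q], which is a radical ideal. *)
have colon d a b : Delta d -> Q (a * b) -> Q (d a * b).
  move=> Dd Qab; have der_d := derDelta Dd; apply: radQ; exists 2.
  have -> : (d a * b) ^+ 2 = d (a * b) * (d a * b) - a * b * (d b * d a).
    by rewrite (derM der_d); ring.
  by apply: idealB => //; apply: ideal_mulr => //; apply: stQ.
pose I : set R := [set a | Q (a * y)].
pose K : set R := [set b | forall a, I a -> Q (a * b)].
have didI : dideal Delta I.
  split; first split.
  - by rewrite /I /= mul0r.
  - by move=> a b Ia Ib; rewrite /I /= mulrDl; apply: QD.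
  - by move=> c a Ia; rewrite /I /= -mulrA; apply: (QM).
  - by move=> d a Dd Ia; apply: colon.
have didK : dideal Delta K.
  split; first split.
  - by move=> a _; rewrite mulr0.
  - by move=> b c Kb Kc a Ia; rewrite mulrDr; apply: QD; [apply: Kb|apply: Kc].
  - by move=> c b Kb a Ia; rewrite mulrCA; apply: (QM); apply: Kb.
  - by move=> d b Dd Kb a Ia; rewrite mulrC; apply: colon => //; rewrite mulrC; apply: Kb.
have [|IQ|KQ] := prQ I K didI didK.
- by apply: ideal_mul_sub => // a b Ia Kb; apply: Kb.
- by left; apply: IQ.
- by right; apply: KQ.
Qed.

Definition dcore M : set R := [set x | exists I, [/\ dideal Delta I, I `<=` M & I x]].

(** The union of the Delta-ideals inside [M] is closed under addition, because the sum of two of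
    them is again one. *)
Lemma dcoreP M : ideal M -> is_dcore Delta M (dcore M).
Proof.
move=> [M0 MD MM]; split=> [|x [I [_ IM /IM]]//|I didI IM x Ix]; last by exists I.
split; first split.
- exists [set 0]; split=> // [|_ ->//].
  split=> [|d _ Dd ->]; last exact: (der0 (derDelta Dd)).
  by split=> // [_ _ -> ->|a _ ->]; rewrite /= ?addr0 ?mulr0.
- move=> x y [I [[[I0 ID IM] stI] IsM Ix]] [K [[[K0 KD KM] stK] KsM Ky]].
  exists [set z | exists a b, [/\ I a, K b & z = a + b]]; split.
  + split; first split.
    * by exists 0, 0; rewrite addr0.
    * move=> _ _ [a [b [Ia Kb ->]]] [c [e [Ic Ke ->]]].
      by exists (a + c), (b + e); rewrite addrACA; split; [exact: ID|exact: KD|].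
    * move=> r _ [a [b [Ia Kb ->]]]; exists (r * a), (r * b).
      by rewrite mulrDr; split; [exact: IM|exact: KM|].
    * move=> d _ Dd [a [b [Ia Kb ->]]]; exists (d a), (d b).
      by rewrite (derD (derDelta Dd)); split; [exact: stI|exact: stK|].
  + by move=> _ [a [b [Ia Kb ->]]]; apply: MD; [exact: IsM|exact: KsM].
  + by exists x, y.
- move=> a x [I [didI IM Ix]]; exists I; split=> //.
  by have [[_ _ I_M] _] := didI; apply: I_M.
- by move=> d x Dd [I [didI IM Ix]]; exists I; split=> //; have [_ st] := didI; apply: st.
Qed.

Lemma dcore_dprime M : prime_ideal M -> dprime Delta (dcore M).
Proof.
move=> [idM M1 prM]; have [didC CM maxC] := dcoreP idM.
split=> // [CT|I K didI didK IK]; first by apply/M1/CM; rewrite CT.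
apply: contrapT => /not_orP[nI nK].
have /existsNP[x /not_implyP[Ix nMx]] : ~ I `<=` M by move=> /(maxC _ didI).
have /existsNP[y /not_implyP[Ky nMy]] : ~ K `<=` M by move=> /(maxC _ didK).
have /prM[] // : M (x * y).
apply/CM/IK => B [_ IKB]; apply: IKB; by exists x => //; exists y.
Qed.

(** Let [f] lie in an ideal defining the complement of a neighborhood of [P], but not in [P]. The
    core of a maximal ideal above [P] without [f] lies in that neighborhood and in the closure of
    [P], hence equals [P]. *)
Lemma locally_closed_dprimitive (P : dspec Delta) : affine R ->
  locally_closed_point P -> dprimitive Delta P.
Proof.
move=> affR [U]; rewrite nbhsE => -[O [openO OP] OU] [C closedC PE].
have dprP := dspecP P; have primeP := dprime_prime (affine_noetherian affR) dprP.
have [I idI OE] : dspec_open O := openO.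
have /existsNP[f /not_implyP[If nPf]] : ~ I `<=` P.
  by move=> IP; have : (~` O) P by rewrite OE.
have [M [maxM PM nMf]] := jacobson affR primeP nPf.
have primeM := maximal_prime maxM; have [idM _ _] := primeM.
have [didC subC maxC] := dcoreP idM.
pose Q := DSpec (dcore_dprime primeM).
have PQ : P `<=` Q by apply: maxC => //; case: dprP.
have OQ : O Q.
  apply: contrapT => nOQ; have : (~` O) Q by [].
  by rewrite OE => /(_ f If)/subC.
have CQ : C Q.
  have [J idJ] : dspec_open (~` C) := closed_openC closedC.
  rewrite setCK => CE; have : C P by have : [set P] P by []; rewrite PE => -[].
  by rewrite CE => JP; apply: subset_trans PQ.
have -> : P = Q.
  apply/esym; have : (C `&` U) Q by split=> //; exact: OU.
  by rewrite -PE.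
by exists M => //; apply: dcoreP.
Qed.

End DeltaPrime.

(** * The center of the fraction field *)

Section Center.
Variables (k : fieldType) (R : comAlgType k) (Delta : set (R -> R)).
Variables (F : fieldType) (f : {rmorphism R -> F}) (P : set R).
Variable D : (R -> R) -> F -> F.
Hypothesis derDelta : Delta `<=` (@derivation k R).
Hypothesis kerf : forall x, f x = 0 <-> P x.
Hypothesis surjf : forall z, exists x y, f y != 0 /\ z = f x / f y.
Hypothesis DE : forall d x y, Delta d -> f y != 0 ->
  D d (f x / f y) = (f (d x) * f y - f x * f (d y)) / f y ^+ 2.

Definition center : set F := [set z | forall d, Delta d -> D d z = 0].

Section PrimitiveRational.
Variable M : set R.
Hypothesis maxM : maximal_ideal M.
Hypothesis coreM : is_dcore Delta M P.

(** Applying [D d] to z r = a gives z (d r) = d a, so the denominators of [z] form a Delta-ideal. It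
    is not inside [P], hence not inside [M]. *)
Lemma center_denominator z : center z -> exists a s, ~ M s /\ z * f s = f a.
Proof.
move=> cz; pose I : set R := [set r | exists a, z * f r = f a].
have didI : dideal Delta I.
  split; first split.
  - by exists 0; rewrite !rmorph0 mulr0.
  - by move=> r t [a ra] [b tb]; exists (a + b); rewrite !rmorphD mulrDr ra tb.
  - by move=> c r [a ra]; exists (c * a); rewrite !rmorphM mulrCA ra.
  - move=> d r Dd [a ra]; exists (d a); have der_d := derDelta Dd.
    have DEd x y := @DE d x y Dd.
    rewrite -!(frac_der_base der_d DEd) -ra (frac_derM surjf der_d DEd).
    by rewrite (cz _ Dd) mul0r add0r.
have [x [y [y0 zE]]] := surjf z.
have Iy : I y by exists x; rewrite zE divfK.
have [_ _ maxP] := coreM.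
have /existsNP[s /not_implyP[[a sa] nMs]] : ~ I `<=` M.
  move=> /(maxP _ didI)/(_ _ Iy)/kerf/eqP; exact/negP.
by exists a, s.
Qed.

(* [z] lies in the local ring of [M] and reduces to the class of [b] in the
   residue field. *)
Definition reduces (z : F) (b : R) :=
  exists a s, [/\ ~ M s, z * f s = f a & M (a - s * b)].

Let primeM := maximal_prime maxM.
Let idM : ideal M. Proof. by case: primeM. Qed.

Lemma reduces_exists z : center z -> exists b, reduces z b.
Proof.
move=> /center_denominator[a [s [nMs sa]]].
have [r Mr] := maximal_inverse maxM nMs.
exists (r * a), a, s; split=> //.
have -> : a - s * (r * a) = (1 - r * s) * a by ring.
exact: ideal_mulr.
Qed.

Lemma reducesD z w b c : reduces z b -> reduces w c -> reduces (z + w) (b + c).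
Proof.
move=> [a [s [nMs sa Mb]]] [e [t [nMt te Mc]]].
exists (a * t + e * s), (s * t); split.
- by have [_ _ pr] := primeM; move=> /pr[].
- by rewrite rmorphD !rmorphM -sa -te; ring.
- have -> : a * t + e * s - s * t * (b + c) = (a - s * b) * t + (e - t * c) * s.
    by ring.
  by have [_ MD _] := idM; apply: MD; apply: ideal_mulr.
Qed.

Lemma reducesM z w b c : reduces z b -> reduces w c -> reduces (z * w) (b * c).
Proof.
move=> [a [s [nMs sa Mb]]] [e [t [nMt te Mc]]].
exists (a * e), (s * t); split.
- by have [_ _ pr] := primeM; move=> /pr[].
- by rewrite !rmorphM -sa -te; ring.
- have -> : a * e - s * t * (b * c) = (a - s * b) * e + (e - t * c) * (s * b).
    by ring.
  by have [_ MD _] := idM; apply: MD; apply: ideal_mulr.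
Qed.

Lemma reduces_base c : reduces (f c) c.
Proof.
exists c, 1; split; first by case: primeM.
  by rewrite rmorph1 mulr1.
by rewrite mul1r subrr; case: idM.
Qed.

Lemma reduces_poly (p : {poly k}) z b : reduces z b ->
  reduces (map_poly (f \o in_alg R) p).[z] (map_poly (in_alg R) p).[b].
Proof.
move=> zb; elim/poly_ind: p => [|p c IH].
  by rewrite !rmorph0 !horner0 -(rmorph0 f); apply: reduces_base.
rewrite !rmorphD !rmorphM /= !map_polyX !map_polyC !hornerMXaddC.
by apply: reducesD; [exact: reducesM|exact: reduces_base].
Qed.

(** If 1 = a / s, then s - a lies in [P], hence in [M]; with b in [M] this would put s in [M]. *)
Lemma reduces_1 b : reduces 1 b -> ~ M b.
Proof.
move=> [a [s [nMs sa Mb]]] Mb'; apply: nMs; have [_ PM _] := coreM.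
have Msa : M (s - a).
  by apply/PM/kerf; rewrite rmorphB -sa mul1r subrr.
have -> : s = (s - a) + (a - s * b) + s * b by ring.
by have [_ MD MM] := idM; apply: (MD); [exact: (MD)|exact: (MM)].
Qed.

(** Let p annihilate the residue b of [z]. If w = p(z) were nonzero, w and 1 / w would both be
    central and have residues, and 1 = w / w would reduce to a multiple of p(b), which is in [M]. *)
Lemma center_algebraic : affine R ->
  forall z, center z -> algebraicOver (f \o in_alg R) z.
Proof.
move=> affR z cz; have [b zb] := reduces_exists cz.
have [p p0 Mpb] := maximal_algebraic affR maxM b.
exists p => //; apply/rootP/eqP; apply: contrapT => /negP w0.
set w := _.[z] in w0.
have cw : center w.
  move=> d Dd; apply: (frac_der_poly surjf (derDelta Dd)) => // [x y|].
    exact: DE.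
  exact: cz.
have cw' : center w^-1.
  move=> d Dd; apply: (frac_derV surjf (derDelta Dd)) => // [x y|].
    exact: DE.
  exact: cw.
have [c wc] := reduces_exists cw'.
have := reducesM (reduces_poly p zb) wc; rewrite mulfV // => /reduces_1; apply.
exact: ideal_mulr.
Qed.

End PrimitiveRational.

End Center.

(** * Eigenvectors in Delta-ideals *)

Section Homogeneous.
Variables (k : fieldType) (R : comAlgType k) (Delta : set (R -> R)).
Variables (r : nat) (act : torus k r -> {lrmorphism R -> R}).
Hypothesis derDelta : Delta `<=` (@derivation k R).
Hypothesis ratA : rational_daction act Delta.

Definition homogeneous (x : R) :=
  exists chi : torus k r -> k, forall h, act h x = chi h *: x.

Definition der_homogeneous (d : R -> R) :=
  exists chi : torus k r -> k, forall h, der_act act h d = chi h *: d.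

Lemma actK h : cancel (act h) (act h^-1%g).
Proof.
by have [[act1 actM] _ _ _ _] := ratA; move=> x; rewrite -actM mulVg act1.
Qed.

Lemma actKV h : cancel (act h^-1%g) (act h).
Proof.
by have [[act1 actM] _ _ _ _] := ratA; move=> x; rewrite -actM mulgV act1.
Qed.

Lemma act_der d x (chi eta : torus k r -> k) : derivation d ->
  (forall h, der_act act h d = chi h *: d) -> (forall h, act h x = eta h *: x) ->
  forall h, act h (d x) = (chi h * eta h) *: d x.
Proof.
move=> der_d dchi xeta h; have := congr1 (fun e => e (act h x)) (dchi h).
rewrite /der_act /= actK => ->; rewrite xeta.
by rewrite -[LHS]/(chi h *: d (eta h *: x)) (derZ der_d) scalerA.
Qed.

Lemma homogeneous_decomposition x :
  exists2 s : seq R, {in s, forall u, homogeneous u} & x = \sum_(u <- s) u.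
Proof.
have [_ [dec _ _] _ _ _] := ratA; have [//|s sP xE] := dec x.
by exists s => // u /sP[_ [chi [_ uchi]]]; exists chi.
Qed.

Lemma der_homogeneous_ind (C : (R -> R) -> Prop) :
  C 0 -> (forall d e, C d -> C e -> C (d \+ e)) ->
  (forall d, Delta d -> der_homogeneous d -> C d) ->
  forall d, Delta d -> C d.
Proof.
move=> C0 CD Chom d Dd; have [_ _ _ _ [dec _ _]] := ratA.
have [s sP ->] := dec d Dd.
rewrite big_seq; apply: (big_ind C C0 CD) => u us.
by have [Du [chi [_ uchi]]] := sP u us; apply: Chom => //; exists chi.
Qed.

(** Induction on the number of terms, possibly repeated or zero, replaces the choice of a shortest
    sum. *)
Lemma homogeneous_incl (F : fieldType) (f : {rmorphism R -> F}) (P Q : set R)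
    (D : (R -> R) -> F -> F) :
  (forall x, f x = 0 <-> P x) ->
  (forall d x y, Delta d -> f y != 0 ->
     D d (f x / f y) = (f (d x) * f y - f x * f (d y)) / f y ^+ 2) ->
  (forall z, center Delta D z -> algebraicOver (f \o in_alg R) z) ->
  ideal P -> dideal Delta Q -> prime_ideal Q -> P `<=` Q ->
  (forall u, homogeneous u -> Q u -> P u) -> Q `<=` P.
Proof.
move=> kerf DE alg idP [idQ stQ] [_ Q1 prQ] PQ homQ.
have [P0 PD PM] := idP; have [Q0 QD QM] := idQ.
suff H n s : size s = n -> {in s, forall u, homogeneous u} ->
    Q (\sum_(u <- s) u) -> P (\sum_(u <- s) u).
  by move=> x; have [s sP ->] := homogeneous_decomposition x; apply: H sP.
elim: n s => [|n IH] [|u s] //; first by rewrite big_nil.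
move=> [ss] hs; have hu : homogeneous u by apply: hs; rewrite mem_head.
have {}hs : {in s, forall w, homogeneous w}.
  by move=> w ws; apply: hs; rewrite inE ws orbT.
rewrite big_cons; set b := \sum_(w <- s) w; set a := u + b => Qa.
have bE : b = a - u by rewrite addrC addKr.
have [Qu|nQu] := EM (Q u).
  have Pu := homQ u hu Qu; apply: PD => //; apply: IH => //.
  by rewrite -/b bE; apply: idealB.
have Pd d : Delta d -> P (u * d a - d u * a).
  move: d; apply: der_homogeneous_ind => [|d e Pd Pe|d Dd hd].
  - by rewrite [X in u * X]/0 [X in X * a]/0 mulr0 mul0r subrr.
  - have -> : u * (d \+ e) a - (d \+ e) u * a =
        (u * d a - d u * a) + (u * e a - e u * a) by rewrite /=; ring.
    exact: PD.
  have der_d := derDelta Dd.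
  (* The contribution of [u] to [a] cancels, leaving one eigenvector for each entry of [s]. *)
  have E : u * d a - d u * a = \sum_(w <- [seq u * d w - d u * w | w <- s]) w.
    rewrite big_map sumrB -!mulr_sumr -/b -(der_sum der_d) -/b /a.
    by rewrite (derD der_d); ring.
  rewrite E; apply: IH; first by rewrite size_map.
    move=> _ /mapP[w ws ->]; have hw := hs w ws.
    have [chi hchi] := hd; have [eta ueta] := hu; have [rho wrho] := hw.
    exists (fun h => chi h * eta h * rho h) => h.
    rewrite rmorphB !rmorphM /= (act_der der_d hchi ueta) (act_der der_d hchi wrho).
    rewrite ueta wrho -!scalerAl -!scalerAr !scalerA scalerBr.
    by congr (_ *: _ - _ *: _); ring.
  rewrite -E; apply: idealB => //; last exact: (QM).
  by apply: (QM); apply: stQ.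
apply: contrapT => nPa; have a0 : f a != 0.
  by apply/eqP => /kerf.
(* The fraction u / a is central: the numerator in its quotient rule vanishes by [Pd]. *)
have [|m [y]] := @algebraic_ratio k R F f u a a0.
  apply: alg => d Dd; rewrite DE //.
  have /kerf := Pd d Dd; rewrite rmorphB !rmorphM => /eqP; rewrite subr_eq0 => /eqP ->.
  by rewrite subrr mul0r.
move=> /kerf/PQ Qum; apply: nQu.
have {Qum} : Q (u ^+ m).
  by rewrite -[u ^+ m](addrK (a * y)); apply: idealB => //; apply: ideal_mulr.
elim: m => [/Q1//|m IHm]; rewrite exprS => /prQ[]; [exact|exact: IHm].
Qed.

End Homogeneous.

(** * Torus orbits *)

Section Torus.
Variables (k : fieldType) (r : nat).
Hypothesis char0 : [pchar k] =i pred0.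

(** The images of the integers below [size A] are distinct and more numerous than the roots of
    [A]. *)
Lemma nonroot (F : fieldType) (psi : {rmorphism k -> F}) (A : {poly F}) :
  A != 0 -> exists t, A.[psi t] != 0.
Proof.
move=> A0; apply: contrapT => noroot.
pose rs := [seq psi n%:R | n <- iota 0 (size A)].
have : (size rs < size A)%N; last by rewrite size_map size_iota ltnn.
apply: max_poly_roots => //.
  apply/allP => _ /mapP[n _ ->]; apply/eqP; apply: contrapT => /eqP An0.
  by apply: noroot; exists n%:R.
rewrite map_inj_uniq ?iota_uniq // => i j /fmorph_inj ij.
have /pcharf0P ch := char0.
wlog leij : i j ij / (i <= j)%N.
  by move=> W; case: (leqP i j) => [|/ltnW] le; [exact: W|apply/esym/W].
have : (j - i)%:R == 0 :> k by rewrite natrB // ij subrr.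
rewrite ch subn_eq0 => leji; apply/eqP; rewrite eqn_leq leij; exact: leji.
Qed.

Section Line.
Variables h0 h1 : torus k r.

Definition line i : {poly k} := (val (h0 i))%:P + 'X * (val (h1 i) - val (h0 i))%:P.

(** It is nonzero exactly at the times when the line lies in the torus. *)
Definition line_denom : {poly k} := \prod_i line i.

(* The point at time [t] of the line through [h0] and [h1]; meaningful only when
   [line_denom] does not vanish at [t]. *)
Definition line_point (t : k) : torus k r :=
  [ffun i => insubd (h0 i) (line i).[t]].

Lemma line_pointE t i : line_denom.[t] != 0 -> val (line_point t i) = (line i).[t].
Proof.
rewrite horner_prod => /prodf_neq0 Lt; rewrite ffunE insubdK //.
exact: Lt.
Qed.

Lemma line0 i : (line i).[0] = val (h0 i).
Proof. by rewrite hornerD hornerM hornerX !hornerC mul0r addr0. Qed.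

Lemma line1 i : (line i).[1] = val (h1 i).
Proof. by rewrite hornerD hornerM hornerX !hornerC mul1r addrC subrK. Qed.

Lemma line_denom0 : line_denom.[0] != 0.
Proof. by rewrite horner_prod; apply/prodf_neq0 => i _; rewrite line0 (valP (h0 i)). Qed.

Lemma line_denom1 : line_denom.[1] != 0.
Proof. by rewrite horner_prod; apply/prodf_neq0 => i _; rewrite line1 (valP (h1 i)). Qed.

Lemma line_point0 : line_point 0 = h0.
Proof.
by apply/ffunP => i; apply: val_inj; rewrite line_pointE ?line_denom0 // line0.
Qed.

Lemma line_point1 : line_point 1 = h1.
Proof.
by apply/ffunP => i; apply: val_inj; rewrite line_pointE ?line_denom1 // line1.
Qed.

Lemma regular_on_line (phi : torus k r -> k) : regular_function phi ->
  exists m (p : {poly k}), forall t, line_denom.[t] != 0 ->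
    phi (line_point t) * line_denom.[t] ^+ m = p.[t].
Proof.
elim=> [c|i|i|f g _ [m [p fp]] _ [n [q gq]]|f g _ [m [p fp]] _ [n [q gq]]].
- by exists 0, c%:P => t _; rewrite mulr1 hornerC.
- by exists 0, (line i) => t Lt; rewrite mulr1 line_pointE.
(* The inverse of a coordinate is the product of the others divided by [line_denom]. *)
- exists 1, (\prod_(j | j != i) line j) => t Lt.
  rewrite line_pointE // expr1 !horner_prod (bigD1 i) //= mulKf //.
  by move: Lt; rewrite horner_prod => /prodf_neq0; apply.
- exists (m + n)%N, (p * line_denom ^+ n + q * line_denom ^+ m) => t Lt.
  rewrite hornerD !hornerM !horner_exp -fp // -gq // exprD; ring.
- exists (m + n)%N, (p * q) => t Lt.
  by rewrite hornerM -fp // -gq // exprD; ring.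
Qed.

End Line.

Variables (R : comAlgType k) (Delta : set (R -> R)).
Variable act : torus k r -> {lrmorphism R -> R}.
Hypothesis ratA : rational_daction act Delta.

(** On each eigenvector the orbit map is a regular function times a constant of [F], and a power of
    [line_denom] makes it polynomial in the time. *)
Lemma act_on_line (F : fieldType) (f : {rmorphism R -> F}) h0 h1 x :
  exists m (A : {poly F}), forall t, (line_denom h0 h1).[t] != 0 ->
    f (act (line_point h0 h1 t) x) * f (line_denom h0 h1).[t]%:A ^+ m = A.[f t%:A].
Proof.
have [_ [dec _ rat] _ _ _] := ratA; have [//|s sP ->] := dec x.
have {}sP : {in s, forall u, exists chi : torus k r -> k,
    regular_function chi /\ forall h, act h u = chi h *: u}.
  move=> u /sP[_ [chi uchi]]; have [_ hu] := uchi.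
  have [X [regX _] chiX] := rat u chi I uchi; exists chi; split=> //.
  by rewrite (_ : chi = fun h => val (X h)) //; apply/funext.
elim: s sP => [_|u s IH sP].
  by exists 0, 0 => t _; rewrite big_nil !rmorph0 mul0r horner0.
have [|m [A sA]] := IH; first by move=> w ws; apply: sP; rewrite inE ws orbT.
have [chi [regchi uchi]] := sP u (mem_head _ _).
have [n [p chip]] := regular_on_line h0 h1 regchi.
pose L := map_poly (f \o in_alg R) (line_denom h0 h1).
have hornerA (q : {poly k}) t : (map_poly (f \o in_alg R) q).[f t%:A] = f q.[t]%:A.
  exact: (horner_map (f \o in_alg R)).
exists (m + n)%N, (A * L ^+ n + map_poly (f \o in_alg R) p * (f u)%:P * L ^+ m).
move=> t Lt; rewrite big_cons !rmorphD /= hornerD !hornerM !horner_exp !hornerA hornerC.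
rewrite -sA // -chip // uchi -mulr_algl rmorphM exprD.
rewrite -[f (_ * _)%:A]/((f \o in_alg R) (_ * _)) rmorphM rmorphXn /=.
ring.
Qed.

(* Restrict the orbit maps of [a] and [b] to the line through [h0] and [h1]:
   they become nonzero rational functions of the time, and [k] is infinite. *)
Lemma orbits_nonzero (F : fieldType) (f : {rmorphism R -> F}) h0 h1 a b :
  f (act h0 a) != 0 -> f (act h1 b) != 0 ->
  exists h, f (act h a) != 0 /\ f (act h b) != 0.
Proof.
move=> a0 b0; pose L := line_denom h0 h1; pose psi : {rmorphism k -> F} := f \o in_alg R.
have [m [A aA]] := act_on_line f h0 h1 a; have [n [B bB]] := act_on_line f h0 h1 b.
have psiL t : L.[t] != 0 -> psi L.[t] != 0 by rewrite (fmorph_eq0 psi).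
have A0 : A != 0.
  apply/eqP => A0; have := aA 0 (line_denom0 h0 h1); rewrite A0 horner0 line_point0.
  by apply/eqP; rewrite mulf_neq0 // expf_neq0 // psiL // line_denom0.
have B0 : B != 0.
  apply/eqP => B0; have := bB 1 (line_denom1 h0 h1); rewrite B0 horner0 line_point1.
  by apply/eqP; rewrite mulf_neq0 // expf_neq0 // psiL // line_denom1.
(* Including this factor ensures that the time found gives a point of the torus. *)
have L0 : map_poly psi L != 0.
  rewrite map_poly_eq0; apply/eqP => L0.
  by have := line_denom0 h0 h1; rewrite -/L L0 horner0 eqxx.
have [t] := nonroot psi (mulf_neq0 (mulf_neq0 A0 B0) L0).
rewrite !hornerM (horner_map psi) !mulf_eq0 (fmorph_eq0 psi) !negb_or.
rewrite -andbA => /and3P[At Bt Lt].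
exists (line_point h0 h1 t); split.
  by apply: contraNneq At => E; rewrite -[psi t]/(f t%:A) -aA // E mul0r.
by apply: contraNneq Bt => E; rewrite -[psi t]/(f t%:A) -bB // E mul0r.
Qed.

Lemma hcoreP Q x : hcore act Q x <-> forall h, Q (act h x).
Proof.
split=> [Qx h|Qx h _].
  have [y Qy <-] := Qx h^-1%g I; by rewrite -{1}[h]invgK (actK ratA).
by exists (act h^-1%g x) => //; apply: (actKV ratA).
Qed.

Lemma sub_hcore Q : hcore act Q `<=` Q.
Proof.
have [[act1 _] _ _ _ _] := ratA.
by move=> x /hcoreP/(_ 1%g); rewrite act1.
Qed.

Lemma hcore_hstable Q : hstable act (hcore act Q).
Proof.
have [[_ actM] _ _ _ _] := ratA.
by move=> h x /hcoreP Qx; apply/hcoreP => g; rewrite -actM.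
Qed.

Lemma sub_hcore_hstable I Q : hstable act I -> I `<=` Q -> I `<=` hcore act Q.
Proof. by move=> stI IQ x Ix; apply/hcoreP => h; apply/IQ/stI. Qed.

(** Acting by [h] on d x is applying the conjugate derivation, again in Delta, to the translate of
    x. *)
Lemma hcore_dstable Q : dstable Delta Q -> dstable Delta (hcore act Q).
Proof.
have [_ _ _ stD _] := ratA; move=> stQ d x Dd /hcoreP Qx; apply/hcoreP => h.
have := stQ _ (act h x) (stD h d Dd) (Qx h).
by rewrite /der_act /= (actK ratA).
Qed.

(** This is irreducibility of the torus: if one translate of [a] and one of [b] leave [Q], a common
    group element moves both out of [Q]. *)
Lemma hcore_prime Q : prime_ideal Q -> prime_ideal (hcore act Q).
Proof.
move=> primeQ; have [[Q0 QD QM] Q1 prQ] := primeQ.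
split; first split.
- by apply/hcoreP => h; rewrite rmorph0.
- move=> x y /hcoreP Qx /hcoreP Qy; apply/hcoreP => h; rewrite rmorphD.
  by apply: QD; [exact: Qx|exact: Qy].
- by move=> a x /hcoreP Qx; apply/hcoreP => h; rewrite rmorphM; apply: (QM); exact: Qx.
- by move=> /sub_hcore.
move=> a b /hcoreP Qab; apply: contrapT => /not_orP[].
move=> /hcoreP/existsNP[h0 nQa] /hcoreP/existsNP[h1 nQb].
have [h [/frac_of_neq0 nQa' /frac_of_neq0 nQb']] := orbits_nonzero
  (iffRL (frac_of_neq0 primeQ _) nQa) (iffRL (frac_of_neq0 primeQ _) nQb).
by have := Qab h; rewrite rmorphM => /prQ[].
Qed.

Lemma hcore_hdprime Q : prime_ideal Q -> dstable Delta Q ->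
  hdprime act Delta (hcore act Q).
Proof.
move=> primeQ stQ; split; [exact: hcore_prime|exact: hcore_hstable|].
exact: hcore_dstable.
Qed.

End Torus.

(** * The cycle of implications *)

Section Main.
Variables (k : fieldType) (R : comAlgType k) (Delta : set (R -> R)).
Variables (r : nat) (act : torus k r -> {lrmorphism R -> R}).
Hypothesis char0 : [pchar k] =i pred0.
Hypothesis derDelta : Delta `<=` (@derivation k R).
Hypothesis ratA : rational_daction act Delta.
Hypothesis affR : affine R.
Implicit Types (P Q : dspec Delta) (J : set R).

Lemma dspec_prime P : prime_ideal P.
Proof. exact (dprime_prime char0 derDelta (affine_noetherian affR) (dspecP P)). Qed.

Lemma dspec_inj P Q : P = Q :> set R -> P = Q.
Proof.
case: P Q => [P dP] [Q dQ] /= PQ; case: Q / PQ dQ => dQ.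
by rewrite (Prop_irrelevance dP dQ).
Qed.

Lemma frac_of_quotient P (primeP : prime_ideal P) (z : fract primeP) :
  exists x y, frac_of primeP y != 0 /\ z = frac_of primeP x / frac_of primeP y.
Proof.
have [x [y [nPy zE]]] := frac_of_surj z; exists x, y; split=> //.
exact/frac_of_neq0.
Qed.

Lemma fract_der_quotient P (primeP : prime_ideal P) d x y :
  Delta d -> frac_of primeP y != 0 ->
  fract_der d (frac_of primeP x / frac_of primeP y) =
    (frac_of primeP (d x) * frac_of primeP y -
     frac_of primeP x * frac_of primeP (d y)) / frac_of primeP y ^+ 2.
Proof.
move=> Dd /frac_of_neq0 nPy; apply: fract_derE nPy => [|z Pz]; first exact: derDelta.
by have [[_ stP] _ _] := dspecP P; apply: stP.
Qed.

Lemma dprimitive_algebraic P (primeP : prime_ideal P) :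
  dprimitive Delta P -> dcenter_fract_algebraic Delta primeP.
Proof.
move=> [M maxM coreM] z cz.
exact: (center_algebraic derDelta (frac_of_eq0 primeP) (@frac_of_quotient P primeP)
  (@fract_der_quotient P primeP) maxM coreM affR).
Qed.

Lemma algebraic_maximal J P (primeP : prime_ideal P) : dspec_stratum act J P ->
  dcenter_fract_algebraic Delta primeP -> maximal_in (dspec_stratum act J) P.
Proof.
move=> JP algP; split=> // Q JQ PQ; apply/dspec_inj/seteqP; split=> //.
have [didQ _ _] := dspecP Q; have [[idP _] _ _] := dspecP P.
apply: (homogeneous_incl derDelta ratA (frac_of_eq0 primeP)
  (@fract_der_quotient P primeP) algP idP didQ (dspec_prime Q) PQ).
(* An eigenvector in [Q] has all its translates in [Q], hence lies in (Q : H) = (P : H). *)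
move=> u [chi uchi] Qu; apply: (sub_hcore ratA); rewrite [hcore _ _]JP -JQ.
apply/(hcoreP ratA) => h; rewrite uchi -mulr_algl.
by have [[_ _ QM] _] := didQ; apply: QM.
Qed.

(** Since [J] is prime, a product of elements outside [J], one from each ideal, stays outside
    [J]. *)
Lemma hdprime_intersection J (s : seq (set R)) : hdprime act Delta J ->
  {in s, forall K : set R, ideal K /\ ~ K `<=` J} ->
  exists x, ~ J x /\ {in s, forall K : set R, K x}.
Proof.
move=> [[_ J1 prJ] _ _]; elim: s => [|K s IH] sP; first by exists 1.
have [|x [nJx sx]] := IH; first by move=> L Ls; apply: sP; rewrite inE Ls orbT.
have [idK /existsNP[y /not_implyP[Ky nJy]]] := sP K (mem_head _ _).
exists (x * y); split=> [/prJ[]//|L]; rewrite inE => /predU1P[->|Ls].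
  by have [_ _ KM] := idK; apply: KM.
by apply: ideal_mulr; [case: (sP L _); rewrite // inE Ls orbT|exact: sx].
Qed.

(** The point [P] is cut out by the closed set of Delta-primes above [P] and the open set of those
    not above [I]. *)
Lemma maximal_locally_closed J P :
  finite_set [set Q : set R | hdprime act Delta Q] -> hdprime act Delta J ->
  maximal_in (dspec_stratum act J) P -> locally_closed_point P.
Proof.
move=> finH hdJ [JP maxP].
pose I : set R := [set x | forall K, hdprime act Delta K -> J `<=` K -> K <> J -> K x].
have idI : ideal I.
  split.
  - by move=> K [[[K0 _ _] _ _] _ _].
  - move=> x y Ix Iy K hdK JK KJ; have [[[_ KD _] _ _] _ _] := hdK.
    by apply: KD; [exact: Ix|exact: Iy].
  - move=> a x Ix K hdK JK KJ; have [[[_ _ KM] _ _] _ _] := hdK.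
    by apply: KM; exact: Ix.
have hI : hstable act I.
  move=> h x Ix K hdK JK KJ; have [_ stK _] := hdK.
  by apply: stK; exact: Ix.
(* Being stable under H, [I] would lie in (P : H) = J, but it is a finite intersection of ideals not
   inside [J]. *)
have nIP : ~ I `<=` P.
  move=> /(sub_hcore_hstable ratA hI) IJ.
  have [s sE] := (finite_seqP _).1 finH.
  have [|x [nJx sx]] := @hdprime_intersection J
      [seq K <- s | `[< J `<=` K /\ K <> J >]] hdJ.
    move=> K; rewrite mem_filter => /andP[/asboolP[JK KJ] Ks].
    have hdK : [set Q : set R | hdprime act Delta Q] K by rewrite sE.
    split; first by have [[]] := hdK.
    by move=> KsJ; apply: KJ; apply/seteqP.
  apply: nJx; rewrite -JP; apply: IJ => K hdK JK KJ; apply: sx.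
  rewrite mem_filter; apply/andP; split; first exact/asboolP.
  by have : [set Q : set R | hdprime act Delta Q] K by []; rewrite sE.
exists (~` [set Q : dspec Delta | I `<=` Q]).
  apply: open_nbhs_nbhs; split; last exact: nIP.
  by exists I => //; rewrite setCK.
exists [set Q : dspec Delta | P `<=` Q].
  rewrite -[X in closed X]setCK; apply: open_closedC.
  have [[idP _] _ _] := dspecP P.
  by exists (P : set R) => //; rewrite setCK.
apply/seteqP; split=> [_ ->|Q [PQ nIQ]]; first by split.
have primeQ := dspec_prime Q; have [[_ stQ] _ _] := dspecP Q.
(* If (Q : H), which contains (P : H) = J, were not [J], it would be one of the ideals intersected
   in [I], and [Q] would contain [I]. *)
have hdQ := hcore_hdprime char0 ratA primeQ stQ.
apply: maxP => //; apply: contrapT => QJ; apply: nIQ => x Ix.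
apply: (sub_hcore ratA); apply: Ix => // y.
rewrite -JP; move=> /(hcoreP ratA) Py; apply/(hcoreP ratA) => h.
exact/PQ/Py.
Qed.

End Main.

Theorem theorem3p3 (k : fieldType) (R : comAlgType k) (Delta : set (R -> R))
    (r : nat) (act : torus k r -> {lrmorphism R -> R}) (J : set R) :
  [pchar k] =i pred0 ->
  Delta `<=` (@derivation k R) ->
  rational_daction act Delta ->
  affine R ->
  finite_set [set Q : set R | hdprime act Delta Q] ->
  hdprime act Delta J ->
  forall P : dspec Delta, dspec_stratum act J P ->
  exists primeP : prime_ideal P,
    [<-> locally_closed_point P;
         dprimitive Delta P;
         dcenter_fract_algebraic Delta primeP;
         maximal_in (dspec_stratum act J) P].
Proof.
move=> char0 derDelta ratA affR finH hdJ P JP.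
(* Primality of [P], needed to form Fract R/P, holds because [R] is noetherian of characteristic
   0. *)
exists (dspec_prime char0 derDelta affR P); tfae.
- exact: locally_closed_dprimitive.
- exact: dprimitive_algebraic.
- exact: algebraic_maximal.
- exact: maximal_locally_closed.
Qed.
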